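(* Let $\mathcal G$ be a locally compact Hausdorff étale groupoid, and let $c:\mathcal G\to\mathbb Z$ be a continuous groupoid cocycle. Let $U_1,U_2\subseteq\mathcal G^{(0)}$ be open $\mathcal G$-invariant subsets, and set $X_i:=\mathcal G^{(0)}\setminus U_i$ for $i=1,2$. Assume that $U_1\cap U_2=\emptyset$. Let $$\rho_i:C^*(\mathcal G)\to C^*(\mathcal G_{X_i}),\qquad \chi_i:C^*(\mathcal G_{X_i})\to C^*(\mathcal G_{X_1\cap X_2})\qquad(i=1,2)$$ be the canonical restriction homomorphisms. Then the square formed by $\rho_1,\rho_2,\chi_1,\chi_2$ (with $\chi_1\circ\rho_1=\chi_2\circ\rho_2$) is a pullback diagram in the category of $\mathbb T$-$C^*$-algebras and $\mathbb T$-equivariant $*$-homomorphisms, where the $\mathbb T$-actions are the gauge actions induced by $c$ and its restrictions to $\mathcal G_{X_1}$, $\mathcal G_{X_2}$ and $\mathcal G_{X_1\cap X_2}$. Equivalently, the map $$C^*(\mathcal G)\longrightarrow C^*(\mathcal G_{X_1})\oplus_{C^*(\mathcal G_{X_1\cap X_2})}C^*(\mathcal G_{X_2}),\qquad a\longmapsto(\rho_1(a),\rho_2(a)),$$ is a $\mathbb T$-equivariant $*$-isomorphism.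
   Context: A topological groupoid $\mathcal G$ (unit space $\mathcal G^{(0)}$, range and source $r,s$) that is locally compact Hausdorff is étale if $r,s:\mathcal G\to\mathcal G^{(0)}$ are local homeomorphisms. A subset $U\subseteq\mathcal G^{(0)}$ is $\mathcal G$-invariant if $s(\gamma)\in U$ implies $r(\gamma)\in U$ for all $\gamma\in\mathcal G$; the complement of an invariant set is invariant. For invariant $U$, $\mathcal G_U:=\{\gamma\in\mathcal G: s(\gamma)\in U\}$ is a subgroupoid with unit space $U$. The space $C_c(\mathcal G)$ is a $*$-algebra under $(f_1*f_2)(\gamma)=\sum_{\alpha\beta=\gamma}f_1(\alpha)f_2(\beta)$ and $f^*(\gamma)=\overline{f(\gamma^{-1})}$; the full groupoid $C^*$-algebra $C^*(\mathcal G)$ is its completion in the universal $C^*$-norm. If $U\subseteq\mathcal G^{(0)}$ is open and invariant and $X=\mathcal G^{(0)}\setminus U$, then $\mathcal G_X$ is a closed étale subgroupoid and the restriction of functions $C_c(\mathcal G)\to C_c(\mathcal G_X)$ extends to a surjective $*$-homomorphism $C^*(\mathcal G)\to C^*(\mathcal G_X)$, called the canonical restriction homomorphism. (The $\chi_i$ are obtained in this way from the groupoid $\mathcal G_{X_i}$ and its closed invariant subset $X_1\cap X_2$.) A continuous cocycle $c:\mathcal G\to\mathbb Z$ (a continuous groupoid homomorphism) induces the gauge action $\gamma$ of $\mathbb T$ on $C^*(\mathcal G)$ determined by $(\gamma_z f)(\eta)=z^{c(\eta)}f(\eta)$ for $f\in C_c(\mathcal G)$, $z\in\mathbb T$. A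 $\mathbb T$-$C^*$-algebra is a $C^*$-algebra with a strongly continuous action of $\mathbb T$; $\Phi:(A,\alpha)\to(B,\beta)$ is $\mathbb T$-equivariant if $\Phi\circ\alpha_z=\beta_z\circ\Phi$ for all $z$. For $*$-homomorphisms $\mu_1:A\to C$, $\mu_2:B\to C$, the pullback is $A\oplus_C B=\{(a,b)\in A\oplus B:\mu_1(a)=\mu_2(b)\}$ with coordinate projections; if everything is $\mathbb T$-equivariant, it carries the componentwise action $\delta_z(a,b)=(\alpha_z(a),\beta_z(b))$ and is the pullback in the category of $\mathbb T$-$C^*$-algebras. *)

(* Defs.v *)
From HB Require Import structures.
From mathcomp Require Import all_boot all_order all_algebra.
From mathcomp Require Import all_classical all_reals all_analysis.
From mathcomp Require Export complex.

Set Implicit Arguments.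
Unset Strict Implicit.
Unset Printing Implicit Defensive.

Import Order.TTheory GRing.Theory Num.Theory.
Import numFieldNormedType.Exports.

Local Open Scope classical_set_scope.
Local Open Scope ring_scope.
Local Open Scope complex_scope.

(* The norm of a [normedModType R[i]] takes its values in [R[i]]; it is real
   and nonnegative there. *)
HB.mixin Record isCstarAlgebra (R : realType) A
    of CompleteNormedModule R[i] A := {
  cmul : A -> A -> A;
  cstar : A -> A;
  cmulA : associative cmul;
  cmul_linearl : forall (a : R[i]) (x y z : A),
    cmul (a *: x + y) z = a *: cmul x z + cmul y z;
  cmul_linearr : forall (a : R[i]) (x y z : A),
    cmul z (a *: x + y) = a *: cmul z x + cmul z y;
  cstar_antilinear : forall (a : R[i]) (x y : A),
    cstar (a *: x + y) = a^* *: cstar x + cstar y;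
  cstarM : forall x y : A, cstar (cmul x y) = cmul (cstar y) (cstar x);
  cstarK : involutive cstar;
  cmul_norm : forall x y : A, `|cmul x y| <= `|x| * `|y|;
  cstar_norm : forall x : A, `|cmul (cstar x) x| = `|x| ^+ 2 }.

#[short(type="cstarAlgType")]
HB.structure Definition CstarAlgebra (R : realType) :=
  {A of CompleteNormedModule R[i] A & isCstarAlgebra R A}.

Record is_star_hom (R : realType) (A B : cstarAlgType R) (phi : A -> B) : Prop := {
  star_hom_linear : linear phi;
  star_hom_mul : {morph phi : x y / cmul x y};
  star_hom_star : {morph phi : x / cstar x} }.

(* The library's norm on a product is the maximum of the two norms, which is the
   C*-norm of the direct sum. *)

HB.instance Definition _ (T T' : puniformType) := Pointed.on (T * T')%type.

Lemma prod_complete (T T' : completeType) (F : set_system (T * T')) :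
  ProperFilter F -> cauchy F -> cvg F.
Proof.
move=> FF Fc.
have F1 : cauchy (fst @ F).
  move=> E entE; have := @Fc [set p | E (p.1.1, p.2.1)].
  case.
    exists (E, setT) => /=; first by split => //; exact: entourageT.
    by move=> [[a b] [c d]] /= [Eab _]; exists ((a, c), (b, d)).
  move=> [P Q] /= [FP FQ] PQ.
  exists (fst @` P, fst @` Q) => /=.
    by split; [apply: filterS FP => x Px; exists x | apply: filterS FQ => x Px; exists x].
  by move=> [_ _] /= [[u Pu <-] [v Qv <-]]; exact: (PQ (u, v)).
have F2 : cauchy (snd @ F).
  move=> E entE; have := @Fc [set p | E (p.1.2, p.2.2)].
  case.
    exists (setT, E) => /=; first by split => //; exact: entourageT.
    by move=> [[a b] [c d]] /= [_ Eab]; exists ((a, c), (b, d)).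
  move=> [P Q] /= [FP FQ] PQ.
  exists (snd @` P, snd @` Q) => /=.
    by split; [apply: filterS FP => x Px; exists x | apply: filterS FQ => x Px; exists x].
  by move=> [_ _] /= [[u Pu <-] [v Qv <-]]; exact: (PQ (u, v)).
move/cauchy_cvg in F1; move/cauchy_cvg in F2.
apply/cvg_ex; exists (lim (fst @ F), lim (snd @ F)).
move=> U [[P Q] [/= /F1 FP /F2 FQ] PQU].
have FPQ : F ((fst @^-1` P) `&` (snd @^-1` Q)) by exact: filterI.
have sU : (fst @^-1` P) `&` (snd @^-1` Q) `<=` U by move=> x [Px Qx]; exact: PQU.
exact: (filterS sU FPQ).
Qed.

HB.instance Definition _ (T T' : completeType) :=
  Uniform_isComplete.Build (T * T')%type (@prod_complete T T').

Section Product.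
Variables (R : realType) (A B : cstarAlgType R).
Implicit Types x y z : (A * B)%type.

Definition prod_cmul x y : A * B := (cmul x.1 y.1, cmul x.2 y.2).
Definition prod_cstar x : A * B := (cstar x.1, cstar x.2).

Lemma prod_cmulA : associative prod_cmul.
Proof. by move=> x y z; rewrite /prod_cmul !cmulA. Qed.

Lemma prod_cmul_linearl (a : R[i]) x y z :
  prod_cmul (a *: x + y) z = a *: prod_cmul x z + prod_cmul y z.
Proof. by rewrite /prod_cmul !cmul_linearl. Qed.

Lemma prod_cmul_linearr (a : R[i]) x y z :
  prod_cmul z (a *: x + y) = a *: prod_cmul z x + prod_cmul z y.
Proof. by rewrite /prod_cmul !cmul_linearr. Qed.

Lemma prod_cstar_antilinear (a : R[i]) x y :
  prod_cstar (a *: x + y) = a^* *: prod_cstar x + prod_cstar y.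
Proof. by rewrite /prod_cstar !cstar_antilinear. Qed.

Lemma prod_cstarM x y :
  prod_cstar (prod_cmul x y) = prod_cmul (prod_cstar y) (prod_cstar x).
Proof. by rewrite /prod_cstar /prod_cmul !cstarM. Qed.

Lemma prod_cstarK : involutive prod_cstar.
Proof. by case=> a b; rewrite /prod_cstar !cstarK. Qed.

Lemma prod_cmul_norm x y : `|prod_cmul x y| <= `|x| * `|y|.
Proof.
rewrite !prod_normE /= comparable_ge_max ?real_comparable ?normr_real//.
have m1 z : `|z.1| <= Num.max `|z.1| `|z.2|.
  by rewrite comparable_le_max ?real_comparable ?normr_real// lexx.
have m2 z : `|z.2| <= Num.max `|z.1| `|z.2|.
  by rewrite comparable_le_max ?real_comparable ?normr_real// lexx orbT.
by apply/andP; split; apply: (le_trans (cmul_norm _ _)); apply: ler_pM.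
Qed.

Lemma prod_cstar_norm x : `|prod_cmul (prod_cstar x) x| = `|x| ^+ 2.
Proof.
rewrite !prod_normE /= !cstar_norm.
have : `|x.1| >=< `|x.2| by rewrite real_comparable ?normr_real.
case/comparable_ltgtP => h; rewrite /Order.max.
- by rewrite ltr_pXn2r ?nnegrE// h.
- by rewrite ltr_pXn2r ?nnegrE// (lt_gtF h).
- by rewrite h ltxx.
Qed.

HB.instance Definition _ := isCstarAlgebra.Build R (A * B)%type
  prod_cmulA prod_cmul_linearl prod_cmul_linearr prod_cstar_antilinear
  prod_cstarM prod_cstarK prod_cmul_norm prod_cstar_norm.

End Product.
Definition circle (R : realType) : set R[i] := [set z | `|z| = 1].

(* An action of the circle on [A] is a map [alpha : R[i] -> A -> A], only the
   values [alpha z] for [z] in the circle being relevant. *)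
Record is_circle_action (R : realType) (A : cstarAlgType R)
    (alpha : R[i] -> A -> A) : Prop := {
  circle_action_hom : forall z, circle z -> is_star_hom (alpha z);
  circle_action1 : forall a, alpha 1 a = a;
  circle_actionM : forall z w, circle z -> circle w ->
    forall a, alpha (z * w) a = alpha z (alpha w a);
  circle_action_cont : forall a,
    {within (@circle R : set R[i]^o),
      continuous (fun z : R[i]^o => alpha z a)} }.

Definition equivariant (R : realType) (A B : cstarAlgType R)
    (alpha : R[i] -> A -> A) (beta : R[i] -> B -> B) (phi : A -> B) :=
  forall z, circle z -> forall a, phi (alpha z a) = beta z (phi a).

Definition is_equivariant_star_hom (R : realType) (A B : cstarAlgType R)
    (alpha : R[i] -> A -> A) (beta : R[i] -> B -> B) (phi : A -> B) :=
  is_star_hom phi /\ equivariant alpha beta phi.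

Definition prod_action (R : realType) (A B : cstarAlgType R)
    (alpha : R[i] -> A -> A) (beta : R[i] -> B -> B) (z : R[i])
    (p : (A * B)%type) : (A * B)%type :=
  (alpha z p.1, beta z p.2).

Definition pullback (A B C : Type) (mu1 : A -> C) (mu2 : B -> C) :
    set (A * B) :=
  [set p | mu1 p.1 = mu2 p.2].

Record is_pullback_square (R : realType) (A B1 B2 C : cstarAlgType R)
    (alpha : R[i] -> A -> A) (beta1 : R[i] -> B1 -> B1)
    (beta2 : R[i] -> B2 -> B2) (kappa : R[i] -> C -> C)
    (rho1 : A -> B1) (rho2 : A -> B2) (chi1 : B1 -> C) (chi2 : B2 -> C) :
    Prop := {
  pullback_actions : [/\ is_circle_action alpha, is_circle_action beta1,
    is_circle_action beta2 & is_circle_action kappa];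
  pullback_homs : [/\ is_equivariant_star_hom alpha beta1 rho1,
    is_equivariant_star_hom alpha beta2 rho2,
    is_equivariant_star_hom beta1 kappa chi1 &
    is_equivariant_star_hom beta2 kappa chi2];
  pullback_commutes : chi1 \o rho1 = chi2 \o rho2;
  pullback_universal :
    forall (D : cstarAlgType R) (delta : R[i] -> D -> D)
      (phi1 : D -> B1) (phi2 : D -> B2),
    is_circle_action delta ->
    is_equivariant_star_hom delta beta1 phi1 ->
    is_equivariant_star_hom delta beta2 phi2 ->
    chi1 \o phi1 = chi2 \o phi2 ->
    exists! phi : D -> A, [/\ is_equivariant_star_hom delta alpha phi,
      rho1 \o phi = phi1 & rho2 \o phi = phi2] }.

(* A groupoid is given by its set of arrows, the units being the arrows [x]
   with [src x = x]; [gmul g h] is meaningful only when [src g = rng h]. *)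
HB.mixin Record isGroupoid G of Choice G := {
  gmul : G -> G -> G;
  ginv : G -> G;
  src : G -> G;
  rng : G -> G;
  src_src : forall g, src (src g) = src g;
  rng_src : forall g, rng (src g) = src g;
  src_rng : forall g, src (rng g) = rng g;
  rng_rng : forall g, rng (rng g) = rng g;
  src_gmul : forall g h, src g = rng h -> src (gmul g h) = src h;
  rng_gmul : forall g h, src g = rng h -> rng (gmul g h) = rng g;
  gmulA : forall g h k, src g = rng h -> src h = rng k ->
    gmul g (gmul h k) = gmul (gmul g h) k;
  gmul_src : forall g, gmul g (src g) = g;
  gmul_rng : forall g, gmul (rng g) g = g;
  src_ginv : forall g, src (ginv g) = rng g;
  rng_ginv : forall g, rng (ginv g) = src g;
  gmulV : forall g, gmul g (ginv g) = rng g;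
  gmulVg : forall g, gmul (ginv g) g = src g }.

#[short(type="groupoidType")]
HB.structure Definition Groupoid := {G of Choice G & isGroupoid G}.

Definition composable (G : groupoidType) : set (G * G) :=
  [set p | src p.1 = rng p.2].

Definition units (G : groupoidType) : set G := [set x | src x = x].

HB.mixin Record isTopologicalGroupoid G of Topological G & Groupoid G := {
  ginv_continuous : continuous (ginv : G -> G);
  gmul_continuous :
    {within @composable G, continuous (fun p : G * G => gmul p.1 p.2)} }.

#[short(type="topGroupoidType")]
HB.structure Definition TopologicalGroupoid :=
  {G of Topological G & Groupoid G & isTopologicalGroupoid G}.

Definition relatively_open (T : topologicalType) (B V : set T) :=
  exists2 W, open W & V = B `&` W.

(* [B] carries the subspace topology of [T']. *)
Definition local_homeomorphism (T T' : topologicalType) (B : set T')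
    (f : T -> T') :=
  (forall x, B (f x)) /\
  forall x, exists U : set T,
    [/\ open U, U x, relatively_open B (f @` U),
        {within U, continuous f} &
        exists2 g : T' -> T, {within f @` U, continuous g} &
          forall y, U y -> g (f y) = y].

Definition etale (G : topGroupoidType) :=
  local_homeomorphism (@units G) (rng : G -> G) /\
  local_homeomorphism (@units G) (src : G -> G).

Definition lch_etale (G : topGroupoidType) :=
  [/\ locally_compact [set: G], hausdorff_space G & etale G].

Definition invariant_set (G : groupoidType) (U : set G) :=
  forall g : G, U (src g) -> U (rng g).

(* For an invariant set [X] of units, the subgroupoid of the arrows with source
   in [X]. The groupoid itself is the reduction to the set of all units. *)
Definition reduction (G : groupoidType) (X : set G) : set G :=
  [set g | X (src g)].

Definition is_cocycle (G : groupoidType) (c : G -> int) :=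
  forall g h, src g = rng h -> c (gmul g h) = c g + c h.

(* A function on the subgroupoid [reduction X] is represented by its extension
   by zero to all arrows; continuity and compactness refer to the subspace
   topology of [reduction X]. *)
Record Cc (R : realType) (G : topGroupoidType) (X : set G) (f : G -> R[i]) :
    Prop := {
  Cc_continuous :
    {within reduction X, continuous (f : G -> R[i]^o)};
  Cc_support : exists K : set G,
    [/\ compact K, K `<=` reduction X & forall g, ~ K g -> f g = 0] }.

(* For [X] invariant and [f1], [f2] vanishing off [reduction X], the factors of
   a nonzero term lie in [reduction X], so that this is the convolution of the
   subgroupoid. *)
Definition convolution (R : realType) (G : groupoidType) (f1 f2 : G -> R[i]) :
    G -> R[i] :=
  fun g => \sum_(p \in [set p | composable p /\ gmul p.1 p.2 = g])
    f1 p.1 * f2 p.2.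

Definition involution (R : realType) (G : groupoidType) (f : G -> R[i]) :
    G -> R[i] :=
  fun g => (f (ginv g))^*.

Definition restriction (R : realType) (G : groupoidType) (X : set G)
    (f : G -> R[i]) : G -> R[i] :=
  patch (fun=> 0) (reduction X) f.

Record is_Cstar_seminorm (R : realType) (G : topGroupoidType) (X : set G)
    (p : (G -> R[i]) -> R) : Prop := {
  seminorm_ge0 : forall f, Cc X f -> 0 <= p f;
  seminorm_add : forall f1 f2, Cc X f1 -> Cc X f2 ->
    p (fun g => f1 g + f2 g) <= p f1 + p f2;
  seminorm_scale : forall (a : R[i]) f, Cc X f ->
    (p (fun g => a * f g))%:C = `|a| * (p f)%:C;
  seminorm_conv : forall f1 f2, Cc X f1 -> Cc X f2 ->
    p (convolution f1 f2) <= p f1 * p f2;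
  seminorm_star : forall f, Cc X f ->
    p (convolution (involution f) f) = p f ^+ 2 }.

(* The universal C*-norm is the largest C*-seminorm; for an etale groupoid these
   seminorms are pointwise bounded, so that [sup] is a true supremum. *)
Definition universal_norm (R : realType) (G : topGroupoidType) (X : set G)
    (f : G -> R[i]) : R :=
  sup [set p f | p in is_Cstar_seminorm X].

(* A completion is determined up to a unique isomorphism compatible with [iota].
   The values of [iota] outside [Cc X] are irrelevant. *)
Record is_full_Cstar_algebra (R : realType) (G : topGroupoidType) (X : set G)
    (A : cstarAlgType R) (iota : (G -> R[i]) -> A) : Prop := {
  iota_linear : forall (a : R[i]) f1 f2, Cc X f1 -> Cc X f2 ->
    iota (fun g => a * f1 g + f2 g) = a *: iota f1 + iota f2;
  iota_conv : forall f1 f2, Cc X f1 -> Cc X f2 ->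
    iota (convolution f1 f2) = cmul (iota f1) (iota f2);
  iota_involution : forall f, Cc X f ->
    iota (involution f) = cstar (iota f);
  iota_norm : forall f, Cc X f -> `|iota f| = (universal_norm X f)%:C;
  iota_dense : closure [set iota f | f in @Cc R G X] = [set: A] }.

(* Used for [Y] contained in [X]; [rho] is unique, being continuous and
   prescribed on a dense subset. *)
Definition is_canonical_restriction (R : realType) (G : topGroupoidType)
    (X Y : set G) (A B : cstarAlgType R) (iotaA : (G -> R[i]) -> A)
    (iotaB : (G -> R[i]) -> B) (rho : A -> B) :=
  is_star_hom rho /\
  forall f, Cc X f -> rho (iotaA f) = iotaB (restriction Y f).

Definition is_gauge_action (R : realType) (G : topGroupoidType) (X : set G)
    (c : G -> int) (A : cstarAlgType R) (iota : (G -> R[i]) -> A)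
    (alpha : R[i] -> A -> A) :=
  forall z, circle z -> is_star_hom (alpha z) /\
    forall f, Cc X f -> alpha z (iota f) = iota (fun g => z ^ c g * f g).

(* Main.v *)
(* For invariant closed [X], the restriction [C*(G) -> C*(G_X)] is the quotient
   by the closure [J_X] of the functions in [Cc(G)] vanishing on [G_X]: the
   quotient norm on [Cc(G_X)] is a C*-seminorm, hence bounded by the universal
   norm of [G_X]. Since [U1] and [U2] are disjoint, the convolution of a
   function vanishing on [G_X1] with one vanishing on [G_X2] is zero, so
   [J_X1 J_X2 = 0] and [a^* a = 0] for [a] in both ideals: this is injectivity.
   For surjectivity, a function on [G_X2] that vanishes on [G_(X1 /\ X2)] extends
   by zero to [G], since [X1] and [X2] cover the units; this makes the kernel
   of [chi2] the image of [J_X1], on which [rho2] is isometric.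

   No spectral theory is used. Norm estimates come from unitaries
   [b + i (1 - c)] with [b^2 + c^2 = 2 c], the elements involved being obtained
   by Banach's fixed point theorem: with [c = 1 - sqrt (1 - b^2)] one gets that
   *-homomorphisms are contractive, and with the Cayley transform an
   approximate unit and the C*-identity of quotients. *)
Require Import Defs.
From HB Require Import structures.
From mathcomp Require Import all_boot all_order all_algebra.
From mathcomp Require Import all_classical all_reals all_analysis.
From mathcomp Require Import complex.
From mathcomp Require Import ring lra.

Import Order.TTheory GRing.Theory Num.Theory.
Import numFieldNormedType.Exports.

Set Implicit Arguments.
Unset Strict Implicit.
Unset Printing Implicit Defensive.

Local Open Scope classical_set_scope.
Local Open Scope ring_scope.
Local Open Scope complex_scope.

(** * C*-algebras *)

(** The universal norm is a real [sup], which has only a default value on an unbounded set;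
    comparing any seminorm with it therefore requires a uniform bound first. For [f] supported on a
    bisection, [f * f^*] lives on the units, where a C*-seminorm of a nonnegative function is at
    most any upper bound of its values, and finite sums of such [f] exhaust [Cc]. Convolution is
    analysed on all of [G] only: Tietze extension lifts a function from a reduction to [G], and
    restriction, being multiplicative and compatible with the involution, brings results back down.

    Algebras have no unit, so multiplication by [1 - c] always appears as [x - cmul c x]. Quotient
    algebras are never formed; only their norm is used. Surjectivity comes from successive
    approximation, in which preimages of controlled norm are needed: the quotient norm supplies them
    for a single restriction, and the isometry of [rho2] on the first ideal supplies them for the
    kernel of [chi2]. *)

Section CstarAlgebras.
Variable R : realType.

Lemma conjCE (z : R[i]) : Num.conj z = conjc z.
Proof. by []. Qed.

Lemma conj_real (t : R) : Num.conj t%:C = t%:C.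
Proof. by rewrite conjCE conjc_real. Qed.

Section Algebra.
Variable A : cstarAlgType R.
Implicit Types (x y z a b c k : A) (t : R).

Lemma cmulDl x y z : cmul (x + y) z = cmul x z + cmul y z.
Proof. by have := cmul_linearl 1 x y z; rewrite !scale1r. Qed.

Lemma cmulDr x y z : cmul z (x + y) = cmul z x + cmul z y.
Proof. by have := cmul_linearr 1 x y z; rewrite !scale1r. Qed.

Lemma cmul0l z : cmul 0 z = 0 :> A.
Proof. by apply: (@addrI _ (cmul 0 z)); rewrite -cmulDl !addr0. Qed.

Lemma cmul0r z : cmul z 0 = 0 :> A.
Proof. by apply: (@addrI _ (cmul z 0)); rewrite -cmulDr !addr0. Qed.

Lemma cmulZl (s : R[i]) x z : cmul (s *: x) z = s *: cmul x z.
Proof. by have := cmul_linearl s x 0 z; rewrite cmul0l !addr0. Qed.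

Lemma cmulZr (s : R[i]) x z : cmul z (s *: x) = s *: cmul z x.
Proof. by have := cmul_linearr s x 0 z; rewrite cmul0r !addr0. Qed.

Lemma cmulNl x z : cmul (- x) z = - cmul x z.
Proof. by rewrite -scaleN1r cmulZl scaleN1r. Qed.

Lemma cmulNr x z : cmul z (- x) = - cmul z x.
Proof. by rewrite -scaleN1r cmulZr scaleN1r. Qed.

Lemma cmulBl x y z : cmul (x - y) z = cmul x z - cmul y z.
Proof. by rewrite cmulDl cmulNl. Qed.

Lemma cmulBr x y z : cmul z (x - y) = cmul z x - cmul z y.
Proof. by rewrite cmulDr cmulNr. Qed.

Lemma cstarD x y : cstar (x + y) = cstar x + cstar y.
Proof. by have := cstar_antilinear 1 x y; rewrite conjC1 !scale1r. Qed.

Lemma cstar0 : cstar 0 = 0 :> A.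
Proof. by apply: (@addrI _ (cstar (0 : A))); rewrite -cstarD !addr0. Qed.

Lemma cstarZ (s : R[i]) x : cstar (s *: x) = s^* *: cstar x.
Proof. by have := cstar_antilinear s x 0; rewrite cstar0 !addr0. Qed.

Lemma cstarZr t x : cstar (t%:C *: x) = t%:C *: cstar x.
Proof. by rewrite cstarZ conj_real. Qed.

Lemma cstarN x : cstar (- x) = - cstar x.
Proof. by rewrite -scaleN1r cstarZ rmorphN1 scaleN1r. Qed.

Lemma cstarB x y : cstar (x - y) = cstar x - cstar y.
Proof. by rewrite cstarD cstarN. Qed.

End Algebra.

(** * Real-valued norms, completeness and closed sets *)

Definition cabs (s : R[i]) : R := complex.Re `|s|.

Lemma cabsE (s : R[i]) : `|s| = (cabs s)%:C.
Proof. by rewrite /cabs RRe_real// normr_real. Qed.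

Lemma cabs0 : cabs 0 = 0.
Proof. by rewrite /cabs normr0. Qed.

Lemma cabs_real (t : R) : cabs t%:C = `|t|.
Proof. by rewrite /cabs normc_def /= expr0n addr0 sqrtr_sqr. Qed.

Lemma cabs_ge0 s : 0 <= cabs s.
Proof. by rewrite -ler0c -cabsE. Qed.

Lemma cabsV s : cabs s^-1 = (cabs s)^-1.
Proof. by apply: (@complexI R); rewrite fmorphV /= -!cabsE normfV. Qed.

(** Norms take their values in [R[i]]; the real part keeps all the information and gives access to
    [inf], [sup] and linear arithmetic in [R]. *)
Definition rnorm (V : normedModType R[i]) (v : V) : R := complex.Re `|v|.

Section Norm.
Variable V : normedModType R[i].
Implicit Types (v w : V) (t : R).

Lemma rnormE v : `|v| = (rnorm v)%:C.
Proof. by rewrite /rnorm RRe_real// normr_real. Qed.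

Lemma rnorm_ge0 v : 0 <= rnorm v.
Proof. by rewrite -ler0c -rnormE. Qed.

Lemma rnormD v w : rnorm (v + w) <= rnorm v + rnorm w.
Proof. by rewrite -lecR rmorphD /= -!rnormE ler_normD. Qed.

Lemma rnorm0 : rnorm (0 : V) = 0.
Proof. by rewrite /rnorm normr0. Qed.

Lemma rnorm_eq0 v : rnorm v = 0 -> v = 0.
Proof. by move=> v0; apply/normr0_eq0; rewrite rnormE v0. Qed.

Lemma rnormN v : rnorm (- v) = rnorm v.
Proof. by rewrite /rnorm normrN. Qed.

Lemma rnormB v w : rnorm (v - w) <= rnorm v + rnorm w.
Proof. by rewrite (le_trans (rnormD _ _))// rnormN. Qed.

Lemma rnorm_distC v w : rnorm (v - w) = rnorm (w - v).
Proof. by rewrite -rnormN opprB. Qed.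

Lemma rnorm_dist_triangle u v w :
  rnorm (v - w) <= rnorm (v - u) + rnorm (u - w).
Proof. by rewrite (le_trans _ (rnormD _ _))// addrA subrK. Qed.

Lemma rnormZ (s : R[i]) v : rnorm (s *: v) = cabs s * rnorm v.
Proof. by apply: (@complexI R); rewrite rmorphM /= -!rnormE normrZ -cabsE. Qed.

Lemma rnormZ_real t v : rnorm (t%:C *: v) = `|t| * rnorm v.
Proof. by rewrite rnormZ cabs_real. Qed.

Lemma rnorm_small0 v : (forall e : R, 0 < e -> rnorm v < e) -> v = 0.
Proof.
move=> h; apply: rnorm_eq0; apply/eqP; rewrite eq_le rnorm_ge0 andbT leNgt.
by apply/negP => /h; rewrite ltxx.
Qed.

End Norm.

Lemma geometric_cvg (V : completeNormedModType R[i]) (u : nat -> V) (C q : R) :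
  0 <= q < 1 -> (forall n, rnorm (u n.+1 - u n) <= C * q ^+ n) ->
  exists l, forall e : R, 0 < e ->
    exists n0, forall n, (n0 <= n)%N -> rnorm (u n - l) < e.
Proof.
move=> /andP[q0 q1] hu.
have C0 : 0 <= C.
  by have := hu 0%N; rewrite expr0 mulr1; apply: le_trans; exact: rnorm_ge0.
have q'0 : 0 < 1 - q by rewrite subr_gt0.
(* The bound is the exact partial sum of the geometric series, which lets the induction on [m]
   close. *)
have tail n m : rnorm (u (n + m)%N - u n) <= C / (1 - q) * q ^+ n * (1 - q ^+ m).
  elim: m => [|m IH]; first by rewrite addn0 subrr rnorm0 expr0 subrr mulr0.
  rewrite (le_trans (rnorm_dist_triangle (u (n + m)%N) _ _))//.
  rewrite addnS (le_trans (lerD (hu _) IH))// exprD.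
  rewrite le_eqVlt; apply/orP; left; apply/eqP; rewrite exprS; field.
  by rewrite gt_eqF.
have small e : 0 < e -> exists n0, forall n, (n0 <= n)%N -> C / (1 - q) * q ^+ n < e.
  move=> e0; have := @cvg_geometric R (C / (1 - q)) q; rewrite ger0_norm// => /(_ q1).
  move=> /cvgrPdist_lt/(_ _ e0) [n0 _ h]; exists n0 => n n0n.
  have := h n n0n; rewrite /geometric /= sub0r normrN ger0_norm//.
  by rewrite mulr_ge0// ?exprn_ge0// divr_ge0// ltW.
have cu : cauchy (u @ \oo).
  apply/cauchy_ballP => e; rewrite ltcE /= => /andP[/eqP ei er].
  have [n0 h] := small (complex.Re e / 2) (divr_gt0 er (ltr0n _ 2)).
  exists (u @` [set n | (n0 <= n)%N], u @` [set n | (n0 <= n)%N]) => /=.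
    by split; exists n0 => // n n0n; exists n.
  move=> [_ _] /= [[n hn <-] [m hm <-]]; rewrite -ball_normE /= rnormE.
  have -> : e = (complex.Re e)%:C by case: e ei {er h} => a b /= ->.
  rewrite ltcR (le_lt_trans (rnorm_dist_triangle (u n0) _ _))//.
  rewrite (splitr (complex.Re e)) ltrD//; last rewrite rnorm_distC.
    have := tail n0 (n - n0)%N; rewrite subnKC// => /le_lt_trans; apply.
    apply: le_lt_trans (h n0 (leqnn _)).
    rewrite ler_piMr ?gerBl ?exprn_ge0// mulr_ge0// ?exprn_ge0//.
    by rewrite divr_ge0// ltW.
  have := tail n0 (m - n0)%N; rewrite subnKC// => /le_lt_trans; apply.
  apply: le_lt_trans (h n0 (leqnn _)).
  rewrite ler_piMr ?gerBl ?exprn_ge0// mulr_ge0// ?exprn_ge0//.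
  by rewrite divr_ge0// ltW.
move/cauchy_cvg in cu; exists (lim (u @ \oo)) => e e0.
move/cvgrPdist_lt : cu => /(_ e%:C); rewrite ltcR => /(_ e0) [n0 _ h].
exists n0 => n /h /=; rewrite rnormE ltcR rnorm_distC; exact.
Qed.

Definition approx_closed (V : normedModType R[i]) (S : set V) :=
  forall x, (forall e : R, 0 < e -> exists2 y, S y & rnorm (y - x) < e) -> S x.

Lemma approx_closedI (V : normedModType R[i]) (S T : set V) :
  approx_closed S -> approx_closed T -> approx_closed (S `&` T).
Proof.
move=> cS cT x h; split; [apply: cS|apply: cT] => e /h[y [Sy Ty] yx];
  by exists y.
Qed.

Lemma approx_closed_ball (V : normedModType R[i]) (t : R) :
  approx_closed [set v : V | rnorm v <= t].
Proof.
move=> x h; rewrite /= leNgt; apply/negP => tx.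
have /h[y /= yt yx] : 0 < rnorm x - t by rewrite subr_gt0.
have := rnormD y (x - y); rewrite addrC subrK rnorm_distC.
by apply/negP; rewrite -ltNge; lra.
Qed.

(** Only additivity is asked of [L], so that the conjugate-linear map [y |-> cstar y - y] is
    covered. *)
Lemma approx_closed_ker (V W : normedModType R[i]) (L : V -> W) (M : R) :
  {morph L : x y / x - y} -> (forall x, rnorm (L x) <= M * rnorm x) ->
  approx_closed [set y | L y = 0].
Proof.
move=> LB LM x h /=; apply: rnorm_small0 => e e0.
have M0 : 0 < `|M| + 1 by rewrite ltr_wpDl.
have [y /= Ly yx] := h (e / (`|M| + 1)) (divr_gt0 e0 M0).
have -> : L x = L (x - y) by rewrite LB Ly subr0.
rewrite (le_lt_trans (LM _))// rnorm_distC.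
apply: (@le_lt_trans _ _ ((`|M| + 1) * rnorm (y - x))).
  by rewrite ler_wpM2r ?rnorm_ge0// (le_trans (ler_norm _))// lerDl.
by rewrite mulrC -ltr_pdivlMr.
Qed.

(** Banach iteration started at 0. The closed set [S] carries side properties over to the fixed
    point: being self-adjoint, commuting with a given element, lying in an ideal. *)
Lemma fixed_point (V : completeNormedModType R[i]) (S : set V) (T : V -> V)
    (q : R) :
  0 <= q < 1 -> S 0 -> (forall x, S x -> S (T x)) ->
  (forall x y, S x -> S y -> rnorm (T x - T y) <= q * rnorm (x - y)) ->
  approx_closed S -> exists2 x, S x & T x = x.
Proof.
move=> q01 S0 ST Tq cS; have /andP[q0 q1] := q01.
pose u n := iter n T 0.
have Su n : S (u n) by elim: n => //= n; exact: ST.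
have [n|l ul] := @geometric_cvg V u (rnorm (T 0)) q q01.
  elim: n => [|n IH]; first by rewrite /u /= subr0 mulr1.
  rewrite exprS mulrCA (le_trans (Tq _ _ (Su n.+1) (Su n)))//.
  by rewrite ler_wpM2l.
have Sl : S l by apply: cS => e /ul[n /(_ n (leqnn n)) h]; exists (u n).
exists l => //; apply/eqP; rewrite -subr_eq0; apply/eqP/rnorm_small0 => e e0.
have [n h] := ul (e / 2) (divr_gt0 e0 (ltr0n _ 2)).
rewrite (le_lt_trans (rnorm_dist_triangle (T (u n)) _ _))// (splitr e).
rewrite ler_ltD//; last exact: h n.+1 (leqnSn n).
rewrite (le_trans (Tq _ _ Sl (Su _)))// rnorm_distC.
rewrite (le_trans _ (ltW (h n (leqnn _))))// ler_piMl ?rnorm_ge0//.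
exact: ltW.
Qed.

(** * Norm estimates from unitaries *)

Section CstarIdentity.
Variable A : cstarAlgType R.
Implicit Types (x y z a b c k h p q : A) (t : R).

Lemma rnormM x y : rnorm (cmul x y) <= rnorm x * rnorm y.
Proof. by rewrite -lecR rmorphM /= -!rnormE cmul_norm. Qed.

Lemma rnorm_starM x : rnorm (cmul (cstar x) x) = rnorm x ^+ 2.
Proof. by apply: (@complexI R); rewrite rmorphXn /= -!rnormE cstar_norm. Qed.

Lemma rnorm_star x : rnorm (cstar x) = rnorm x.
Proof.
have le y : rnorm y <= rnorm (cstar y).
  have [->|y0] := eqVneq (rnorm y) 0; first exact: rnorm_ge0.
  have yp : 0 < rnorm y by rewrite lt_def y0 rnorm_ge0.
  by rewrite -(ler_pM2r yp) -expr2 -rnorm_starM rnormM.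
by apply/eqP; rewrite eq_le le andbT -{2}[x]cstarK le.
Qed.

Lemma ler_rnorm2 x t : 0 <= t -> rnorm x ^+ 2 <= t ^+ 2 -> rnorm x <= t.
Proof. by move=> t0; rewrite ler_pXn2r// nnegrE// rnorm_ge0. Qed.

Lemma half_addK (V : lmodType R[i]) (v : V) : (2^-1 : R)%:C *: (v + v) = v.
Proof.
rewrite -mulr2n -[v *+ 2]scaler_nat scalerA -(rmorph_nat (real_complex R)) -rmorphM /=.
by rewrite mulVf ?pnatr_eq0// scale1r.
Qed.

(* [p + i q] and [p - i q] both have the norm of [x], and [p] is half their
   sum. *)
Lemma rotation_le x p q : cmul (cstar p) q = cmul (cstar q) p ->
  cmul (cstar p) p + cmul (cstar q) q = cmul (cstar x) x ->
  rnorm p <= rnorm x.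
Proof.
move=> pq ppqq.
have aux (s : R[i]) : conjc s = - s -> s * s = -1 ->
    rnorm (p + s *: q) = rnorm x.
  move=> ss s2; apply/eqP; rewrite -(eqrXn2 (n:=2))// ?rnorm_ge0// -!rnorm_starM.
  rewrite cstarD cstarZ conjCE ss cmulDl !cmulDr !cmulZl !cmulZr scalerA mulNr s2.
  by rewrite opprK scale1r pq scaleNr addrA addrK ppqq.
have [i [i1 i2]] : exists i : R[i], conjc i = - i /\ i * i = -1.
  by exists 'i%R; split; [exact: (@conjCi R[i])|rewrite -expr2 (@sqrCi R[i])].
have h1 := aux _ i1 i2.
have h2 : rnorm (p + (- i) *: q) = rnorm x.
  by apply: aux; rewrite ?mulrNN// rmorphN /= i1.
have -> : p = (2^-1 : R)%:C *: ((p + i *: q) + (p + (- i) *: q)).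
  by rewrite scaleNr addrACA subrr addr0 half_addK.
rewrite rnormZ_real ger0_norm ?invr_ge0// mulrC ler_pdivrMr//.
by rewrite mulr_natr mulr2n (le_trans (rnormD _ _))// h1 h2.
Qed.

(* [b + i (1 - c)] is unitary in the unitization. *)
Lemma unitary_part_le b c x : cstar b = b -> cstar c = c ->
  cmul b c = cmul c b -> cmul b b + cmul c c = c + c ->
  rnorm (cmul b x) <= rnorm x /\ rnorm (x - cmul c x) <= rnorm x.
Proof.
move=> bs cs bc bbcc.
have pq : cmul (cstar (cmul b x)) (x - cmul c x) =
    cmul (cstar (x - cmul c x)) (cmul b x).
  rewrite cstarB !cstarM bs cs cmulBr cmulBl -!cmulA; congr (_ - cmul _ _).
  by rewrite !cmulA bc.
have ppqq : cmul (cstar (cmul b x)) (cmul b x) +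
    cmul (cstar (x - cmul c x)) (x - cmul c x) = cmul (cstar x) x.
  have bb : cmul b b = c + c - cmul c c by rewrite -bbcc addrK.
  rewrite cstarB !cstarM bs cs cmulBr !cmulBl -!cmulA [cmul b (cmul b x)]cmulA bb.
  rewrite [cmul c (cmul c x)]cmulA.
  set u := cmul c c; rewrite cmulBl cmulDl cmulBr cmulDr.
  set v := cmul _ (cmul c x); set w := cmul _ (cmul u x).
  by rewrite -(addrA v v) -(addrA _ (- v)) -opprD [LHS]addrC subrK.
split; first exact: rotation_le ppqq.
by apply: (rotation_le (q := cmul b x)); [rewrite pq|rewrite addrC].
Qed.

(** For [x := b] the first bound of [unitary_part_le] reads [|b|^2 = |b b| <= |b|]; this replaces
    evaluation at a unit. *)
Lemma unitary_part_le1 b c : cstar b = b -> cstar c = c ->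
  cmul b c = cmul c b -> cmul b b + cmul c c = c + c -> rnorm b <= 1.
Proof.
move=> bs cs bc bbcc; have [+ _] := unitary_part_le b bs cs bc bbcc.
rewrite -{1}bs rnorm_starM; have [->//|b0] := eqVneq (rnorm b) 0.
by rewrite expr2 ger_pMl// lt_def b0 rnorm_ge0.
Qed.

Lemma approx_closed_selfadjoint : approx_closed [set y : A | cstar y = y].
Proof.
suff -> : [set y : A | cstar y = y] = [set y | cstar y - y = 0].
  apply: (@approx_closed_ker _ _ _ 2) => [x y|x].
    by rewrite cstarB !opprB [y - x]addrC addrACA [- cstar y + y]addrC.
  by rewrite (le_trans (rnormB _ _))// rnorm_star mulr_natl mulr2n.
by apply/seteqP; split => y /= => [->|/eqP]; rewrite ?subrr// subr_eq0 => /eqP.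
Qed.

Lemma approx_closed_commutant h : approx_closed [set y : A | cmul h y = cmul y h].
Proof.
suff -> : [set y : A | cmul h y = cmul y h] = [set y | cmul h y - cmul y h = 0].
  apply: (@approx_closed_ker _ _ _ (2 * rnorm h)) => [x y|x].
    by rewrite cmulBr cmulBl !opprB [cmul y h - _]addrC addrACA [- _ + cmul y h]addrC.
  rewrite (le_trans (rnormB _ _))// mulr_natl mulr2n mulrDl.
  by rewrite lerD ?rnormM// mulrC rnormM.
by apply/seteqP; split => y /= => [->|/eqP]; rewrite ?subrr// subr_eq0 => /eqP.
Qed.

(* [y = 1 - sqrt (1 - h^2)] is the fixed point of [y |-> (h^2 + y^2) / 2]. *)
Lemma sqrt_exists h : cstar h = h -> rnorm h < 1 ->
  exists y, [/\ cstar y = y, cmul h y = cmul y h &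
    cmul h h + cmul y y = y + y].
Proof.
(* [t] is both the radius of the ball and the contraction constant: on that ball
   [|T x| <= (t + t^2) / 2 <= t], and [x^2 - y^2 = x (x - y) + (x - y) y] has norm at most
   [2 t |x - y|]. *)
move=> hs h1; pose t := rnorm h ^+ 2.
have t01 : 0 <= t < 1 by rewrite exprn_ge0 ?rnorm_ge0//= expr_lt1// rnorm_ge0.
have /andP[t0 t1] := t01.
pose T y := (2^-1 : R)%:C *: (cmul h h + cmul y y).
pose S := [set y : A | cstar y = y] `&` [set y | cmul h y = cmul y h] `&`
  [set y | rnorm y <= t].
have half v s : rnorm v <= s + s -> rnorm ((2^-1 : R)%:C *: v) <= s.
  rewrite rnormZ_real ger0_norm ?invr_ge0// mulrC ler_pdivrMr//.
  by rewrite mulr_natr mulr2n.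
have [|x [[xs hx] xt]|x y [_ xt] [_ yt]||y [[ys hy] _] Ty] :=
  @fixed_point A S T t t01.
- by split; [split; rewrite /= ?cstar0 ?cmul0l ?cmul0r|rewrite /= rnorm0].
- split; [split|] => /=.
  + by rewrite cstarZr cstarD !cstarM hs xs.
  + rewrite cmulZl cmulZr cmulDl cmulDr cmulA; congr (_ *: (_ + _)).
    by rewrite cmulA hx -cmulA hx cmulA.
  + apply: half; rewrite (le_trans (rnormD _ _))// lerD//.
      by rewrite (le_trans (rnormM _ _)).
    rewrite (le_trans (rnormM _ _))// (le_trans (ler_pM _ _ xt xt)) ?rnorm_ge0//.
    by rewrite ler_piMl// ltW.
- rewrite -scalerBr; apply: half.
  rewrite opprD addrACA subrr add0r.
  have -> : cmul x x - cmul y y = cmul x (x - y) + cmul (x - y) y.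
    by rewrite cmulBr cmulBl addrA subrK.
  rewrite (le_trans (rnormD _ _))// lerD// (le_trans (rnormM _ _))//.
    by rewrite ler_wpM2r ?rnorm_ge0.
  by rewrite mulrC ler_wpM2r ?rnorm_ge0.
- apply: approx_closedI; last exact: approx_closed_ball.
  apply: approx_closedI; first exact: approx_closed_selfadjoint.
  exact: approx_closed_commutant.
- exists y; split => //; rewrite -[in RHS]Ty /T -scalerDr.
  by rewrite half_addK.
Qed.

End CstarIdentity.

(** * Contractivity of *-homomorphisms *)

Section StarHom.
Variables (A B : cstarAlgType R) (phi : A -> B).
Hypothesis hphi : is_star_hom phi.

Lemma star_homD x y : phi (x + y) = phi x + phi y.
Proof. by have := star_hom_linear hphi 1 x y; rewrite !scale1r. Qed.

Lemma star_hom0 : phi 0 = 0.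
Proof. by apply: (@addrI _ (phi 0)); rewrite -star_homD !addr0. Qed.

Lemma star_homZ (s : R[i]) x : phi (s *: x) = s *: phi x.
Proof. by have := star_hom_linear hphi s x 0; rewrite star_hom0 !addr0. Qed.

Lemma star_homB x y : phi (x - y) = phi x - phi y.
Proof. by rewrite star_homD -scaleN1r star_homZ scaleN1r. Qed.

(** The relation [h^2 + y^2 = 2 y] is preserved by [phi], so [phi h] is again the real part of a
    unitary. *)
Lemma star_hom_selfadjoint_le1 h : cstar h = h -> rnorm h < 1 ->
  rnorm (phi h) <= 1.
Proof.
move=> hs h1; have [y [ys hy e]] := sqrt_exists hs h1.
apply: (@unitary_part_le1 _ _ (phi y)).
- by rewrite -(star_hom_star hphi) hs.
- by rewrite -(star_hom_star hphi) ys.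
- by rewrite -!(star_hom_mul hphi) hy.
- by rewrite -!(star_hom_mul hphi) -!star_homD e.
Qed.

(** The self-adjoint case is applied to [x^* x / r^2] with [r] slightly larger than [|x|], because
    it requires norm strictly below 1. *)
Lemma star_hom_le x : rnorm (phi x) <= rnorm x.
Proof.
apply/ler_addgt0Pr => e e0; set r := rnorm x + e.
have xr : rnorm x < r by rewrite ltrDl.
have r0 : 0 < r by rewrite (le_lt_trans (rnorm_ge0 _) xr).
have r20 : 0 < r ^+ 2 by rewrite exprn_gt0.
have := @star_hom_selfadjoint_le1 ((r ^- 2)%:C *: cmul (cstar x) x).
rewrite cstarZr cstarM cstarK star_homZ (star_hom_mul hphi) (star_hom_star hphi).
rewrite !rnormZ_real !rnorm_starM ger0_norm; last by rewrite invr_ge0 ltW.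
rewrite ![r ^- 2 * _]mulrC => /(_ erefl); rewrite ltr_pdivrMr// mul1r => h.
have : rnorm x ^+ 2 < r ^+ 2 by rewrite ltr_pXn2r// nnegrE ?rnorm_ge0// ltW.
by move/h; rewrite ler_pdivrMr// mul1r; apply: ler_rnorm2; exact: ltW.
Qed.

End StarHom.

Lemma star_hom_comp (A B C : cstarAlgType R) (phi : A -> B) (psi : B -> C) :
  is_star_hom phi -> is_star_hom psi -> is_star_hom (psi \o phi).
Proof.
move=> h1 h2; split => [s x y|x y|x] /=.
- by rewrite (star_hom_linear h1) (star_hom_linear h2).
- by rewrite (star_hom_mul h1) (star_hom_mul h2).
- by rewrite (star_hom_star h1) (star_hom_star h2).
Qed.

Lemma star_hom_id (A : cstarAlgType R) : is_star_hom (@id A).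
Proof. by split. Qed.

(** * Closed ideals and approximate units *)

Record is_closed_ideal (A : cstarAlgType R) (I : set A) : Prop := {
  ideal0 : I 0;
  idealD : forall x y, I x -> I y -> I (x + y);
  idealZ : forall (s : R[i]) x, I x -> I (s *: x);
  ideal_mull : forall a x, I x -> I (cmul a x);
  ideal_star : forall x, I x -> I (cstar x);
  ideal_closed : approx_closed I }.

Section Ideal.
Variables (A : cstarAlgType R) (I : set A).
Hypothesis hI : is_closed_ideal I.
Implicit Types (x y z a b c k e h : A).

Lemma ideal_mulr x a : I x -> I (cmul x a).
Proof.
move=> Ix; rewrite -[cmul x a]cstarK cstarM.
by apply: (ideal_star hI); apply: (ideal_mull hI); exact: ideal_star.
Qed.

Lemma idealN x : I x -> I (- x).
Proof. by rewrite -scaleN1r; exact: idealZ. Qed.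

Lemma idealB x y : I x -> I y -> I (x - y).
Proof. by move=> Ix /idealN; exact: idealD. Qed.

(** With [y = 1 - sqrt (1 - h^2)] one has [1 - h^2 = (1 - y)^2], and multiplication by [1 - y] does
    not increase norms. *)
Lemma one_minus_square_le h x : cstar h = h -> rnorm h < 1 ->
  rnorm (x - cmul (cmul h h) x) <= rnorm x.
Proof.
move=> hs h1; have [y [ys hy e]] := sqrt_exists hs h1.
have [_ le1] := unitary_part_le x hs ys hy e.
have [_ le2] := unitary_part_le (x - cmul y x) hs ys hy e.
apply: le_trans le1; apply: le_trans le2.
have hh : cmul h h = y + y - cmul y y by rewrite -e addrK.
rewrite [X in rnorm X <= _](_ : _ = x - cmul y x - cmul y (x - cmul y x))// hh.
rewrite cmulBl cmulDl cmulBr -!cmulA !opprB.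
by rewrite opprD [RHS]addrACA [LHS]addrA.
Qed.

(* [e = k^2 (s^2 + k^2)^-1]; with [c := k / s], [1 - 2 e] and
   [(2 / s) k (1 - e)] are the real and imaginary part of the Cayley transform
   [(1 + i c) (1 - i c)^-1]. *)
Lemma ideal_approx_unit k s : I k -> cstar k = k -> 0 < s ->
  exists e, [/\ I e, cstar e = e, forall x, rnorm (x - cmul e x) <= rnorm x &
    rnorm (k - cmul e k) <= s].
Proof.
move=> Ik ks s0; set r := rnorm k + 1.
have kr : rnorm k < r by rewrite ltrDl.
have r0 : 0 < r by rewrite (le_lt_trans (rnorm_ge0 _) kr).
have r20 : 0 < r ^+ 2 by rewrite exprn_gt0.
have s20 : 0 < s ^+ 2 by rewrite exprn_gt0.
have M0 : 0 < r ^+ 2 + s ^+ 2 by rewrite addr_gt0.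
have rle x : rnorm ((r ^+ 2)%:C *: x - cmul (cmul k k) x) <= r ^+ 2 * rnorm x.
  have := @one_minus_square_le ((r^-1)%:C *: k) x.
  rewrite cstarZr ks rnormZ_real ger0_norm; last by rewrite invr_ge0 ltW.
  rewrite mulrC ltr_pdivrMr// mul1r => /(_ erefl kr).
  rewrite !(cmulZl, cmulZr) scalerA -rmorphM /=.
  move=> le1; rewrite -{2}[r ^+ 2]ger0_norm ?(ltW r20)//.
  have -> : (r ^+ 2)%:C *: x - cmul (cmul k k) x =
      (r ^+ 2)%:C *: (x - (r^-1 * r^-1)%:C *: cmul (cmul k k) x).
    rewrite scalerBr scalerA -rmorphM /= -expr2 -exprMn divff ?gt_eqF// expr1n.
    by rewrite scale1r.
  by rewrite rnormZ_real ler_wpM2l.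
(* [T e = e] amounts to [(s^2 + k^2) e = k^2]. Since [r^2 - k^2] acts with norm at most [r^2], [T]
   contracts by [r^2 / (r^2 + s^2)]. *)
pose T e := ((r ^+ 2 + s ^+ 2)^-1)%:C *:
  ((r ^+ 2)%:C *: e - cmul (cmul k k) e + cmul k k).
pose S := I `&` [set y : A | cstar y = y] `&` [set y | cmul k y = cmul y k].
have q01 : 0 <= r ^+ 2 / (r ^+ 2 + s ^+ 2) < 1.
  by rewrite divr_ge0 ?(ltW r20) ?(ltW M0)//= ltr_pdivrMr// mul1r ltrDl.
have [|x [[Ix xs] kx]|x y _ _||e [[Ie es] ke] Te] := @fixed_point A S T _ q01.
- by split; [split|]; rewrite /= ?cstar0 ?cmul0l ?cmul0r//; exact: ideal0 hI.
- split; [split|] => /=.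
  + apply: (idealZ hI); apply: (idealD hI); last exact: ideal_mull.
    by apply: idealB; [exact: idealZ|exact: ideal_mull].
  + rewrite cstarZr cstarD cstarB cstarZr !cstarM ks xs.
    by rewrite cmulA -kx -cmulA -kx cmulA.
  + rewrite cmulZl cmulZr cmulDr cmulDl cmulBr cmulBl cmulZl cmulZr kx.
    by rewrite -!cmulA kx.
- rewrite -scalerBr opprD addrACA subrr addr0 rnormZ_real.
  rewrite ger0_norm; last by rewrite invr_ge0 ltW.
  rewrite [_ / _]mulrC -mulrA ler_wpM2l//.
    by rewrite invr_ge0 ltW.
  have := rle (x - y); rewrite scalerBr cmulBr; apply: le_trans.
  rewrite le_eqVlt; apply/orP; left; apply/eqP; congr (rnorm _).
  by rewrite !opprD [LHS]addrACA.
- apply: approx_closedI; last exact: approx_closed_commutant.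
  by apply: approx_closedI; [exact: ideal_closed|exact: approx_closed_selfadjoint].
- have kke : cmul k k - cmul (cmul k k) e = (s ^+ 2)%:C *: e.
    have : (r ^+ 2 + s ^+ 2)%:C *: T e = (r ^+ 2 + s ^+ 2)%:C *: e by rewrite Te.
    rewrite /T scalerA -rmorphM /= divff ?gt_eqF// scale1r rmorphD /= scalerDl.
    by rewrite -addrA => /addrI; rewrite addrC.
  pose w := k - cmul e k.
  have wk : cmul w k = (s ^+ 2)%:C *: e.
    by rewrite -kke /w cmulBl -ke -!cmulA ke.
  have ws : cstar w = w by rewrite /w cstarB cstarM ks es ke.
  have ew : cmul e w = cmul w e.
    by rewrite /w cmulBr cmulBl ke -cmulA ke.
  have ww : cmul w w = (s ^+ 2)%:C *: (e - cmul e e).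
    by rewrite {2}/w cmulBr -ke cmulA wk cmulZl -scalerBr.
  have s2 : (2 / s * (2 / s)) * s ^+ 2 = 4 by field; rewrite gt_eqF.
  (* With [b := (2 / s) w] and [c := 2 e], the identity [w^2 = s^2 (e - e^2)] gives
     [b^2 = 4 e - 4 e^2], and adding [c^2 = 4 e^2] leaves [4 e = 2 c]. *)
  have [] : cstar ((2 / s)%:C *: w) = (2 / s)%:C *: w /\ cstar (2%:C *: e) = 2%:C *: e.
    by rewrite !cstarZr ws es.
  move=> bs cs.
  have bc : cmul ((2 / s)%:C *: w) (2%:C *: e) = cmul (2%:C *: e) ((2 / s)%:C *: w).
    by rewrite !cmulZl !cmulZr ew !scalerA mulrC.
  have bbcc : cmul ((2 / s)%:C *: w) ((2 / s)%:C *: w) +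
      cmul (2%:C *: e) (2%:C *: e) = 2%:C *: e + 2%:C *: e.
    have -> : cmul (2%:C *: e) (2%:C *: e) = 4%:C *: cmul e e.
      rewrite cmulZl cmulZr scalerA; congr (_ *: _).
      by apply/eqP; rewrite eq_complex /=; apply/andP; split; apply/eqP; ring.
    rewrite !cmulZl !cmulZr ww !scalerA -!rmorphM /= s2 scalerBr.
    by rewrite subrK -scalerDl -rmorphD /=; congr (_%:C *: _); ring.
  exists e; split => // [x|].
    have [_] := unitary_part_le x bs cs bc bbcc.
    rewrite cmulZl => le1.
    (* [1 - e] is the mean of [1] and [1 - 2 e]. *)
    have -> : x - cmul e x = (2^-1 : R)%:C *: (x + (x - 2%:C *: cmul e x)).
      rewrite addrA scalerBr half_addK scalerA -rmorphM /= mulVf ?pnatr_eq0//.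
      by rewrite scale1r.
    rewrite rnormZ_real ger0_norm ?invr_ge0// mulrC ler_pdivrMr//.
    by rewrite mulr_natr mulr2n (le_trans (rnormD _ _))// lerD.
  (* [|b| <= 1] even yields [2 |w| <= s]. *)
  have := unitary_part_le1 bs cs bc bbcc.
  rewrite rnormZ_real ger0_norm; last by rewrite divr_ge0// ltW.
  rewrite mulrAC ler_pdivrMr// mul1r; apply: le_trans.
  by rewrite ler_peMl ?rnorm_ge0// ler1n.
Qed.

End Ideal.

(** * The quotient norm of a closed ideal *)

Section QuotientNorm.
Variables (A : cstarAlgType R) (I : set A).
Hypothesis hI : is_closed_ideal I.
Implicit Types (x y z a b c k e h : A).

Definition quotient_norm a : R := inf [set rnorm (a + k) | k in I].

Let coset_has_inf a : has_inf [set rnorm (a + k) | k in I].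
Proof.
split; first by exists (rnorm (a + 0)), 0 => //; exact: ideal0 hI.
by exists 0 => _ [k _ <-]; exact: rnorm_ge0.
Qed.

Lemma quotient_norm_le a k : I k -> quotient_norm a <= rnorm (a + k).
Proof. by move=> Ik; apply: ge_inf; [exact: (coset_has_inf a).2|exists k]. Qed.

Lemma quotient_norm_lb a t : (forall k, I k -> t <= rnorm (a + k)) ->
  t <= quotient_norm a.
Proof.
by move=> h; apply: lb_le_inf; [exact: (coset_has_inf a).1|move=> _ [k /h + <-]].
Qed.

Lemma quotient_norm_lt a t : quotient_norm a < t ->
  exists2 k, I k & rnorm (a + k) < t.
Proof.
by move/(inf_lt (coset_has_inf a).1) => [_ [k Ik <-]] kt; exists k.
Qed.

Lemma quotient_norm_ge0 a : 0 <= quotient_norm a.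
Proof. by apply: quotient_norm_lb => k _; exact: rnorm_ge0. Qed.

Lemma quotient_norm_le_norm a : quotient_norm a <= rnorm a.
Proof. by have := quotient_norm_le a (ideal0 hI); rewrite addr0. Qed.

Lemma quotient_norm_eq a b : I (a - b) -> quotient_norm a = quotient_norm b.
Proof.
have le x y : I (x - y) -> quotient_norm x <= quotient_norm y.
  move=> Ixy; apply: quotient_norm_lb => k Ik.
  have -> : y + k = x + (k - (x - y)) 
    by rewrite opprB [RHS]addrCA [x + _]addrC subrK addrC.
  by apply: quotient_norm_le; exact: (idealB hI).
by move=> Iab; apply/eqP; rewrite eq_le !le// -opprB; exact: (idealN hI).
Qed.

Lemma quotient_normD a b : quotient_norm (a + b) <= quotient_norm a + quotient_norm b.
Proof.
rewrite -lerBlDr; apply: quotient_norm_lb => k Ik.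
rewrite lerBlDr -lerBlDl; apply: quotient_norm_lb => l Il; rewrite lerBlDl.
rewrite (le_trans (quotient_norm_le _ (idealD hI Ik Il)))// addrACA.
exact: rnormD.
Qed.

Lemma quotient_normZ (s : R[i]) a :
  quotient_norm (s *: a) = cabs s * quotient_norm a.
Proof.
have le (u : R[i]) x : quotient_norm (u *: x) <= cabs u * quotient_norm x.
  have [u0|u0] := eqVneq u 0.
    by rewrite u0 scale0r cabs0 mul0r (le_trans (quotient_norm_le_norm _))// rnorm0.
  have up : 0 < cabs u by rewrite -ltcR -cabsE normr_gt0.
  rewrite -ler_pdivrMl//; apply: quotient_norm_lb => k Ik.
  rewrite ler_pdivrMl// -rnormZ scalerDr; apply: quotient_norm_le.
  exact: (idealZ hI).
apply/eqP; rewrite eq_le le/=.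
have [s0|s0] := eqVneq s 0.
  by rewrite s0 cabs0 mul0r quotient_norm_ge0.
have sp : 0 < cabs s by rewrite -ltcR -cabsE normr_gt0.
have := le s^-1 (s *: a).
by rewrite scalerA mulVf// scale1r cabsV ler_pdivlMl.
Qed.

Lemma quotient_normM a b :
  quotient_norm (cmul a b) <= quotient_norm a * quotient_norm b.
Proof.
have le k l : I k -> I l ->
    quotient_norm (cmul a b) <= rnorm (a + k) * rnorm (b + l).
  move=> Ik Il; apply: le_trans (rnormM _ _); rewrite cmulDl cmulDr -addrA.
  apply: quotient_norm_le; apply: (idealD hI); first exact: (ideal_mull hI).
  exact: (ideal_mulr hI).
(* The infimum is taken over one factor at a time, dividing by the other; a factor of norm zero is
   treated apart. *)
have le2 l : I l -> quotient_norm (cmul a b) <= quotient_norm a * rnorm (b + l).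
  move=> Il; have [b0|b0] := eqVneq (rnorm (b + l)) 0.
    by have := le 0 l (ideal0 hI) Il; rewrite b0 !mulr0.
  have bp : 0 < rnorm (b + l) by rewrite lt_def b0 rnorm_ge0.
  rewrite -ler_pdivrMr//; apply: quotient_norm_lb => k Ik.
  by rewrite ler_pdivrMr// le.
have [a0|a0] := eqVneq (quotient_norm a) 0.
  by have := le2 0 (ideal0 hI); rewrite a0 !mul0r.
have ap : 0 < quotient_norm a by rewrite lt_def a0 quotient_norm_ge0.
rewrite -ler_pdivrMl//; apply: quotient_norm_lb => k Ik.
by rewrite ler_pdivrMl// le2.
Qed.

Lemma quotient_norm_star a : quotient_norm (cstar a) = quotient_norm a.
Proof.
have le x : quotient_norm (cstar x) <= quotient_norm x.
  apply: quotient_norm_lb => k Ik; rewrite -rnorm_star cstarD.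
  by apply: quotient_norm_le; exact: (ideal_star hI).
by apply/eqP; rewrite eq_le le -{1}[a]cstarK le.
Qed.

(** For the hard inequality, [a - a e] is in the coset of [a], and its squared norm is that of
    [(1 - e) a^* a (1 - e)]. Adding and subtracting [(1 - e) k' (1 - e)] bounds this by
    [|a^* a + k'| + s], once the approximate unit [e] nearly fixes [k']. *)
Lemma quotient_norm_starM a :
  quotient_norm (cmul (cstar a) a) = quotient_norm a ^+ 2.
Proof.
apply/eqP; rewrite eq_le; apply/andP; split.
  by rewrite (le_trans (quotient_normM _ _))// quotient_norm_star expr2.
apply: quotient_norm_lb => k Ik; set x := cmul (cstar a) a.
have xs : cstar x = x by rewrite /x cstarM cstarK.
(* The approximate unit is built for self-adjoint elements; as [x] is self-adjoint, passing to the
   self-adjoint part of [k] does not increase [|x + k|]. *)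
pose k' := (2^-1 : R)%:C *: (k + cstar k).
have Ik' : I k'.
  by apply: (idealZ hI); apply: (idealD hI) => //; exact: (ideal_star hI).
have k's : cstar k' = k' by rewrite /k' cstarZr cstarD cstarK addrC.
have xk : rnorm (x + k') <= rnorm (x + k).
  have -> : x + k' = (2^-1 : R)%:C *: ((x + k) + cstar (x + k)).
    by rewrite cstarD xs addrACA scalerDr half_addK.
  rewrite rnormZ_real ger0_norm ?invr_ge0// mulrC ler_pdivrMr//.
  by rewrite mulr_natr mulr2n (le_trans (rnormD _ _))// rnorm_star.
apply: le_trans xk; apply/ler_addgt0Pr => s s0.
have [e [Ie es le1 kes]] := ideal_approx_unit hI Ik' k's s0.
have le1r z : rnorm (z - cmul z e) <= rnorm z.
  by have := le1 (cstar z); rewrite -[in X in X -> _]es -cstarM -cstarB !rnorm_star.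
pose z := cstar a - cmul e (cstar a).
have zE : cstar z = a - cmul a e by rewrite /z cstarB cstarM cstarK es.
apply: (@le_trans _ _ (rnorm (cstar z) ^+ 2)).
  rewrite ler_pXn2r ?nnegrE ?quotient_norm_ge0 ?rnorm_ge0// zE.
  apply: quotient_norm_le; apply: (idealN hI); exact: (ideal_mull hI).
rewrite -rnorm_starM cstarK zE.
pose P y := y - cmul e y; pose Q y := y - cmul y e.
have QB y y' : Q (y - y') = Q y - Q y'.
  by rewrite /Q cmulBl !opprD !opprK [LHS]addrACA.
have PB y y' : P (y - y') = P y - P y'.
  by rewrite /P cmulBr !opprD !opprK [LHS]addrACA.
have -> : cmul z (a - cmul a e) = Q (P x).
  by rewrite /Q /P /z cmulBr cmulA !cmulBl -!cmulA.
have -> : Q (P x) = Q (P (x + k')) - Q (P k') by rewrite -QB -PB addrK.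
rewrite (le_trans (rnormB _ _))// lerD ?(le_trans (le1r _) (le1 _))//.
by rewrite (le_trans (le1r _)).
Qed.

Lemma quotient_norm_eq0 a : quotient_norm a <= 0 -> I a.
Proof.
move=> a0; apply: (ideal_closed hI) => e e0.
have [k Ik ake] := @quotient_norm_lt a e (le_lt_trans a0 e0).
by exists (- k); [exact: (idealN hI)|rewrite rnorm_distC opprK].
Qed.

End QuotientNorm.

(** Successive approximation, as for the open mapping theorem: the residuals [b_ n] stay in [S] and
    halve at each step, while the corrections [f (b_ n)], of norm at most [2 |b0| / 2^n], sum to an
    element of [I]. *)
Lemma onto_of_approx (V W : completeNormedModType R[i]) (phi : V -> W)
    (I : set V) (S : set W) :
  {morph phi : x y / x + y} -> (forall x, rnorm (phi x) <= rnorm x) ->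
  I 0 -> (forall x y, I x -> I y -> I (x + y)) -> approx_closed I ->
  (forall b, S b -> exists a, [/\ I a, rnorm a <= 2 * rnorm b,
    rnorm (b - phi a) <= rnorm b / 2 & S (b - phi a)]) ->
  forall b, S b -> exists2 a, I a & phi a = b.
Proof.
move=> phiD phile I0 ID Icl H b0 Sb0.
have /choice[f Hf] b : exists a, S b -> [/\ I a, rnorm a <= 2 * rnorm b,
    rnorm (b - phi a) <= rnorm b / 2 & S (b - phi a)].
  by have [/H[a ?]|nSb] := pselect (S b); [exists a|exists 0].
pose b_ n := iter n (fun b => b - phi (f b)) b0.
have Sb n : S (b_ n) by elim: n => //= n /Hf[].
have bn n : rnorm (b_ n) <= rnorm b0 * 2^-1 ^+ n.
  elim: n => [|n IH]; first by rewrite mulr1.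
  have [_ _ + _] := Hf _ (Sb n); move/le_trans; apply.
  by rewrite exprSr mulrA ler_wpM2r// invr_ge0.
pose u n := \sum_(i < n) f (b_ i).
have Iu n : I (u n).
  by rewrite /u; elim/big_ind : _ => // i _; have [] := Hf _ (Sb i).
have phiu n : b0 - phi (u n) = b_ n.
  elim: n => [|n IH].
    rewrite /u big_ord0 (_ : phi 0 = 0) ?subr0//.
    by apply: (@addrI _ (phi 0)); rewrite -phiD !addr0.
  by rewrite /u big_ord_recr /= phiD opprD addrA IH.
have q01 : 0 <= (2^-1 : R) < 1 by rewrite invr_ge0 ler0n/= invf_lt1 ?ltr1n.
have [n|l ul] := @geometric_cvg _ u (2 * rnorm b0) (2^-1) q01.
  rewrite /u big_ord_recr /= [X in rnorm X]addrC addKr; have [_ h _ _] := Hf _ (Sb n).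
  by rewrite (le_trans h)// -mulrA ler_wpM2l.
have Il : I l by apply: Icl => e /ul[n /(_ n (leqnn n)) h]; exists (u n).
exists l => //; apply/eqP; rewrite -subr_eq0; apply/eqP/rnorm_small0 => e e0.
have e2 : 0 < e / 2 by rewrite divr_gt0.
have [n1 h1] := ul _ e2.
have half1 : `|2^-1 : R| < 1.
  by have /andP[h0 h1'] := q01; rewrite ger0_norm.
have /cvgrPdist_lt/(_ _ e2)[n2 _ h2] := @cvg_geometric R (rnorm b0) _ half1.
pose n := maxn n1 n2.
have phiB x y : phi (x - y) = phi x - phi y.
  by apply: (@addIr _ (phi y)); rewrite -phiD !subrK.
rewrite (le_lt_trans (rnorm_dist_triangle (phi (u n)) _ _))// (splitr e).
rewrite ltrD// -?phiB; last rewrite rnorm_distC phiu.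
  by rewrite (le_lt_trans (phile _))// rnorm_distC h1// leq_maxl.
rewrite (le_lt_trans (bn n))//; have := h2 n (leq_maxr _ _).
rewrite /geometric /= sub0r normrN ger0_norm//.
by rewrite mulr_ge0 ?rnorm_ge0// exprn_ge0// invr_ge0.
Qed.
End CstarAlgebras.

(** * Functions with compact support on an etale groupoid *)

Section Cutoff.
Variables (R : realType) (T : topologicalType).
Implicit Types (f g : T -> R[i]) (psi : T -> R).

Lemma cvg_rnormP (V : normedModType R[i]) (F : set_system T) {FF : Filter F}
    (f : T -> V) (l : V) :
  f @ F --> l <->
  forall e : R, 0 < e -> \forall y \near F, rnorm (f y - l) < e.
Proof.
split=> [/cvgrPdist_lt h e e0|h].
  have := h e%:C; rewrite ltcR => /(_ e0); apply: filterS => y.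
  by rewrite rnormE ltcR rnorm_distC.
apply/cvgrPdist_lt => e; rewrite ltcE /= => /andP[/eqP ei er].
have := h _ er; apply: filterS => y; rewrite rnorm_distC => hy.
have -> : e = (complex.Re e)%:C by case: e ei {er h hy} => a b /= ->.
by rewrite rnormE ltcR.
Qed.

Lemma cvg_cabsP (F : set_system T) {FF : Filter F} f (l : R[i]) :
  (f : T -> R[i]^o) @ F --> (l : R[i]^o) <->
  forall e : R, 0 < e -> \forall y \near F, cabs (f y - l) < e.
Proof. exact: (@cvg_rnormP R[i]^o). Qed.

Lemma cvg_real_complex (F : set_system T) {FF : Filter F} psi (l : R) :
  (psi : T -> R^o) @ F --> (l : R^o) ->
  ((fun y => (psi y)%:C) : T -> R[i]^o) @ F --> (l%:C : R[i]^o).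
Proof.
move=> /(@cvgrPdist_lt _ R^o) h; apply/cvg_cabsP => e /h; apply: filterS => y.
by rewrite -rmorphB /= cabs_real distrC.
Qed.

Lemma cvg_conjc (F : set_system T) {FF : Filter F} f (l : R[i]) :
  (f : T -> R[i]^o) @ F --> (l : R[i]^o) ->
  ((fun y => conjc (f y)) : T -> R[i]^o) @ F --> (conjc l : R[i]^o).
Proof.
move=> /cvg_cabsP h; apply/cvg_cabsP => e /h; apply: filterS => y.
by rewrite -rmorphB /= /cabs normcJ.
Qed.

Lemma cvg_Re (F : set_system T) {FF : Filter F} f (l : R[i]) :
  (f : T -> R[i]^o) @ F --> (l : R[i]^o) ->
  ((fun y => complex.Re (f y)) : T -> R^o) @ F --> (complex.Re l : R^o).
Proof.
move=> /cvg_cabsP h; apply/(@cvgrPdist_lt _ R^o) => e /h; apply: filterS => y.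
apply: le_lt_trans; rewrite -lecR -cabsE -raddfB distrC.
by rewrite (le_trans _ (normc_ge_Re _))// raddfB.
Qed.

Lemma normc_ge_Im (a : R[i]) : `|complex.Im a|%:C <= `|a|.
Proof. by rewrite normc_def lecR -sqrtr_sqr ler_wsqrtr// lerDr sqr_ge0. Qed.

Lemma cvg_Im (F : set_system T) {FF : Filter F} f (l : R[i]) :
  (f : T -> R[i]^o) @ F --> (l : R[i]^o) ->
  ((fun y => complex.Im (f y)) : T -> R^o) @ F --> (complex.Im l : R^o).
Proof.
move=> /cvg_cabsP h; apply/(@cvgrPdist_lt _ R^o) => e /h; apply: filterS => y.
apply: le_lt_trans; rewrite -lecR -cabsE -raddfB distrC.
by rewrite (le_trans _ (normc_ge_Im _))// raddfB.
Qed.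

(** A Urysohn function [phi] is only known to be constant on [A] and on [B]. Truncating [2 - 3 phi]
    to values between 0 and 1 gives the value 1 on the open set [phi < 1/3] and the value 0 off the
    closed set [phi <= 2/3]. *)
Lemma urysohn_cutoff (A B : set T) : @uniform_separator T A B ->
  exists psi (O C : set T), [/\ continuous psi, forall x, 0 <= psi x <= 1,
    open O /\ A `<=` O, closed C /\ (forall x, B x -> ~ C x) &
    (forall x, O x -> psi x = 1) /\ (forall x, ~ C x -> psi x = 0)].
Proof.
move/(@uniform_separatorP _ R) => [phi [cphi _ phiA phiB]].
pose psi x := Num.max 0 (Num.min 1 (2 - 3 * phi x)).
have clt : continuous ((fun x => 2 - 3 * phi x) : T -> R^o).
  move=> x; apply: (@cvgB R R^o _ _ _ (fun=> 2) (fun x => 3 * phi x)).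
    exact: cvg_cst.
  by apply: (@cvgM R _ _ _ (fun=> 3) phi); [exact: cvg_cst|exact: cphi].
exists psi, [set x | phi x < 1 / 3], [set x | phi x <= 2 / 3]; split => [x|x|||].
- apply: (@continuous_max _ _ (fun=> 0) _ x); first exact: cvg_cst.
  apply: (@continuous_min _ _ (fun=> 1) _ x); first exact: cvg_cst.
  exact: clt.
- by rewrite /psi le_max lexx/= ge_max ler01 ge_min lexx.
- split.
    by apply: (@open_comp _ _ phi [set t | t < 1 / 3]) => //; exact: open_lt.
  move=> x Ax /=; have -> : phi x = 0 by apply: phiA; exists x.
  by rewrite divr_gt0.
- split.
    by apply: (@closed_comp _ _ phi [set t | t <= 2 / 3]) => //; exact: closed_le.
  move=> x Bx /=; have -> : phi x = 1 by apply: phiB; exists x.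
  by apply/negP; rewrite -ltNge ltr_pdivrMr// mul1r ltr_nat.
- split=> x /=.
    by move=> h; rewrite /psi min_l ?max_r//; lra.
  move/negP; rewrite -ltNge => h.
  by rewrite /psi min_r ?max_l//; lra.
Qed.

End Cutoff.

Section GroupoidAlgebra.
Variable G : groupoidType.
Implicit Types (g h a b : G).

Lemma ginvK g : ginv (ginv g) = g.
Proof.
rewrite -[LHS]gmul_src src_ginv rng_ginv -gmulVg.
by rewrite gmulA ?src_ginv ?rng_ginv// gmulVg src_ginv gmul_rng.
Qed.

Lemma gmulKV a g : rng a = rng g -> gmul a (gmul (ginv a) g) = g.
Proof.
by move=> ag; rewrite gmulA ?rng_ginv ?src_ginv// gmulV ag gmul_rng.
Qed.

Lemma gmulVK a b : src a = rng b -> gmul (ginv a) (gmul a b) = b.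
Proof.
by move=> ab; rewrite gmulA ?src_ginv// gmulVg ab gmul_rng.
Qed.

Lemma composable_ginv a g : rng a = rng g -> composable (ginv a, g).
Proof. by rewrite /composable /= src_ginv. Qed.

Lemma ginv_unit (x : G) : units x -> ginv x = x.
Proof.
move=> xu; rewrite /units /= in xu.
have rx : rng x = x by rewrite -[in LHS]xu rng_src xu.
by rewrite -[LHS]gmul_src src_ginv rx gmulVg.
Qed.

End GroupoidAlgebra.

Lemma local_homeomorphism_continuous (T T' : topologicalType) (B : set T')
  (f : T -> T') : local_homeomorphism B f -> continuous f.
Proof.
move=> [_ hf] x; have [U [oU Ux _ cf _]] := hf x.
by move: cf; rewrite continuous_open_subspace// => /(_ x); apply; rewrite inE.
Qed.

(* The library's [compact_cover] assumes that the space is pointed. *)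
Lemma compact_finite_cover (T : topologicalType) (K : set T) (W : T -> set T) :
  compact K -> (forall x, open (W x) /\ W x x) ->
  exists s : seq T, forall g, K g -> exists2 i, i \in s & W i g.
Proof.
move=> cK hW; apply: contrapT => nW.
pose B (s : seq T) := K `&` [set g | ~ exists2 i, i \in s & W i g].
have FB : ProperFilter (filter_from [set: seq T] B).
  apply: filter_from_proper => [|s _].
    apply: filter_from_filter; first by exists [::].
    move=> s t _ _; exists (s ++ t) => // g [Kg h]; split; split => // -[i it Wi];
      by apply: h; exists i => //; rewrite mem_cat it ?orbT.
  apply: contrapT => nB; apply: nW; exists s => g Kg.
  by apply: contrapT => h; apply: nB; exists g.
have [|p [Kp clp]] := cK (filter_from [set: seq T] B) FB.
  by exists [::] => // g [].
have [oW Wp] := hW p.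
have [||q [[_ nq] Wq]] := clp (B [:: p]) (W p); first by exists [:: p].
  exact: open_nbhs_nbhs.
by apply: nq; exists p => //; rewrite inE.
Qed.

(** * Bisections, convolution and bounds on C*-seminorms *)

Section EtaleGroupoid.
Variables (R : realType) (G : topGroupoidType).
Hypothesis hG : lch_etale G.
Implicit Types (f h : G -> R[i]) (a b g x : G).

Let G_lc : locally_compact [set: G]. Proof. by case: hG. Qed.
Let G_hausdorff : hausdorff_space G. Proof. by case: hG. Qed.

Lemma rng_continuous : continuous (rng : G -> G).
Proof. by case: hG => _ _ [/local_homeomorphism_continuous]. Qed.

Lemma src_continuous : continuous (src : G -> G).
Proof. by case: hG => _ _ [_ /local_homeomorphism_continuous]. Qed.

Lemma units_rng g : units (rng g). Proof. exact: src_rng. Qed.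

Lemma units_src g : units (src g). Proof. exact: src_src. Qed.

Lemma reduction_units : reduction (@units G) = setT.
Proof. by apply/seteqP; split => // g _; exact: units_src. Qed.

Lemma CcP f : Cc (@units G) f <->
  continuous (f : G -> R[i]^o) /\
  exists2 K, compact K & forall g, ~ K g -> f g = 0.
Proof.
split=> [[cf [K [cK _ Kf]]]|[cf [K cK Kf]]].
  split; last by exists K.
  by apply/continuous_subspace_setT; rewrite -reduction_units.
split; first by rewrite reduction_units; exact: (continuous_subspace_setT _).1 cf.
by exists K; split => // g _; exact: units_src.
Qed.

(** The range map is inverted on an open set [U] around [C], so that the section [sigma] is defined
    and continuous near the ranges of [C]; of the source map, injectivity on [C] is recorded. *)
Definition is_bisection (C : set G) := exists U sigma,
  [/\ open U /\ C `<=` U, relatively_open (@units G) (rng @` U),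
    {within rng @` U, continuous (sigma : G -> G)},
    forall y, U y -> sigma (rng y) = y &
    forall a b, C a -> C b -> src a = src b -> a = b].

Definition bisection_supported f := exists K,
  [/\ compact K, is_bisection K & forall g, ~ K g -> f g = 0].

Lemma is_bisectionS (C D : set G) : C `<=` D -> is_bisection D -> is_bisection C.
Proof.
move=> CD [U [sigma [[oU DU] rU cs sK inj]]]; exists U, sigma; split => //.
  by split => //; exact: subset_trans DU.
by move=> a b /CD Ca /CD Cb; exact: inj.
Qed.

Lemma bisection_cutoff x : exists (psi : G -> R) (O C : set G),
  [/\ continuous psi, open O /\ O x, closed C /\ is_bisection C,
    forall g, O g -> psi g = 1 & forall g, ~ C g -> psi g = 0].
Proof.
case: hG => _ _ [[_ hr] [_ hs]].
have [U [oU Ux rU _ [sigma csigma sigmaK]]] := hr x.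
have [V [oV Vx _ _ [tau _ tauK]]] := hs x.
have sep : uniform_separator [set x] (~` (U `&` V)).
  apply: (locally_compact_completely_regular (R := R) G_lc G_hausdorff).
    by apply: open_closedC; exact: openI.
  by apply; split.
have [psi [W [C [cpsi _ [oW xW] [cC CUV] [psi1 psi0]]]]] := @urysohn_cutoff R _ _ _ sep.
have CUV' : C `<=` U `&` V.
  by move=> g Cg; apply: contrapT => /CUV; exact.
exists psi, W, C; split => //; first by split => //; exact: xW.
split => //; exists U, sigma; split => //; first by split => // g /CUV'[].
by move=> a b /CUV'[_ Va] /CUV'[_ Vb] ab; rewrite -(tauK _ Va) ab tauK.
Qed.

(** A partition of unity in inductive form. The support is covered by finitely many open sets [W i]
    on which [psi i] is 1; in [f = f psi + f (1 - psi)] the first term is supported on a bisection,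
    and the second vanishes on [W i], hence off a shorter list of sets. *)
Lemma Cc_ind (P : (G -> R[i]) -> Prop) :
  P (fun=> 0) ->
  (forall f h, Cc (@units G) f -> Cc (@units G) h -> P f -> P h ->
    P (fun g => f g + h g)) ->
  (forall f, Cc (@units G) f -> bisection_supported f -> P f) ->
  forall f, Cc (@units G) f -> P f.
Proof.
move=> P0 PD PB f /CcP[cf [K cK Kf]].
have /choice[psi /choice[W /choice[C psiP]]] := bisection_cutoff.
have [x|D KD] := @compact_finite_cover _ K W cK; first by have [] := psiP x.
have : forall g, ~ (exists2 i, i \in D & W i g) -> f g = 0.
  by move=> g nD; apply: Kf => /KD.
elim: D f cf Kf {KD} => [|i s IH] f cf Kf sf.
  have -> // : f = fun=> 0.
  by apply/funext => g; apply: sf => -[].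
have [cpsi [_ _] [cC bC] psi1 psi0] := psiP i.
pose f1 g := f g * (psi i g)%:C; pose f2 g := f g * (1 - psi i g)%:C.
have -> : f = fun g => f1 g + f2 g.
  by apply/funext => g; rewrite /f1 /f2 -mulrDr -rmorphD /= addrC subrK mulr1.
have cf1 : continuous (f1 : G -> R[i]^o).
  move=> g; apply: cvgM; first exact: cf.
  by apply: cvg_real_complex; exact: cpsi.
have cf2 : continuous (f2 : G -> R[i]^o).
  move=> g; apply: cvgM; first exact: cf.
  apply: (@cvg_real_complex _ _ _ _ (fun y => 1 - psi i y)).
  by apply: (@cvgB R R^o _ _ _ (fun=> 1) (psi i)); [exact: cvg_cst|exact: cpsi].
have Kf1 g : ~ K g -> f1 g = 0 by move=> /Kf fg; rewrite /f1 fg mul0r.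
have Kf2 g : ~ K g -> f2 g = 0 by move=> /Kf fg; rewrite /f2 fg mul0r.
have Cf1 : Cc (@units G) f1 by apply/CcP; split => //; exists K.
have Cf2 : Cc (@units G) f2 by apply/CcP; split => //; exists K.
apply: (PD f1 f2 Cf1 Cf2).
- apply: PB => //; exists (K `&` C i); split.
  + exact: compact_closedI.
  + by apply: is_bisectionS bC => g [].
  + move=> g KCg; have [Kg|/Kf1//] := pselect (K g).
    by rewrite /f1 psi0 ?mulr0// => Cg; apply: KCg.
- apply: IH => // g nOg; rewrite /f2.
  have [Og|nOig] := pselect (W i g); first by rewrite psi1// subrr mulr0.
  rewrite sf ?mul0r// => -[j]; rewrite inE => /orP[/eqP->//|js Ojg].
  by apply: nOg; exists j.
Qed.

(** A sum over a set is 0 by convention when infinitely many terms are nonzero; finite fibres make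
    convolution an actual sum, additive in its first factor. *)
Lemma Cc_finite_fiber f x : Cc (@units G) f ->
  finite_set [set a | rng a = x /\ f a != 0].
Proof.
move: f; apply: Cc_ind => [|f h _ _ ff fh|f _ [K [_ [U [sigma [[_ KU] _ _ sK _]]] Kf]]].
- by apply: (sub_finite_set _ (finite_set0 _)) => a /= [_]; rewrite eqxx.
- apply: (@sub_finite_set _ _ ([set a | rng a = x /\ f a != 0] `|`
    [set a | rng a = x /\ h a != 0])); last first.
    by rewrite finite_setU; split; [exact: ff|exact: fh].
  move=> a /= [ra fh0]; have [fa|fa] := eqVneq (f a) 0; last by left.
  by right; move: fh0; rewrite fa add0r.
- apply: (sub_finite_set _ (finite_set1 (sigma x))) => a /= [<- fa].
  rewrite sK//; apply: KU; apply: contrapT => /Kf fa0.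
  by rewrite fa0 eqxx in fa.
Qed.

Lemma convolution_addl f1 f2 h : Cc (@units G) f1 -> Cc (@units G) f2 ->
  convolution (fun g => f1 g + f2 g) h =
  fun g => convolution f1 h g + convolution f2 h g.
Proof.
move=> Cf1 Cf2; apply/funext => g; rewrite /convolution.
pose S : set (G * G) := [set p | composable p /\ gmul p.1 p.2 = g].
(* One finite index set that contains the nonzero terms of all three sums. *)
pose F : set (G * G) := S `&` [set p | f1 p.1 != 0 \/ f2 p.1 != 0].
have Ffin : finite_set F.
  apply: (@sub_finite_set _ _ ((fun a => (a, gmul (ginv a) g)) @`
    ([set a | rng a = rng g /\ f1 a != 0] `|`
     [set a | rng a = rng g /\ f2 a != 0]))).
    move=> [a b] [[]]; rewrite /composable /= => ab <- f12.
    exists a; first by case: f12 => ?; [left|right]; rewrite rng_gmul.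
    by rewrite gmulVK.
  by apply: finite_image; rewrite finite_setU; split; exact: Cc_finite_fiber.
have toF (f : G -> R[i]) : (forall a, f1 a = 0 -> f2 a = 0 -> f a = 0) ->
    \sum_(p \in S) f p.1 * h p.2 = \sum_(p \in F) f p.1 * h p.2.
  move=> f0; apply/esym; apply: fsbig_widen; first by move=> p [].
  move=> p [Sp nFp] /=; rewrite f0 ?mul0r//.
    have [//|f1p] := eqVneq (f1 p.1) 0; case: nFp; split => //; by left.
  have [//|f1p] := eqVneq (f2 p.1) 0; case: nFp; split => //; by right.
rewrite (toF f1)// (toF f2)// (toF (fun g => f1 g + f2 g)); last first.
  by move=> a -> ->; rewrite addr0.
rewrite -fsbig_split//; apply: eq_fsbigr => p _; exact: mulrDl.
Qed.

(** The only factorization of [g] that contributes is [a (a^-1 g)]. For [f] supported on a bisection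
    this turns convolution into a pointwise formula. *)
Lemma convolution_at f h a g : rng a = rng g ->
  (forall b, rng b = rng g -> f b != 0 -> b = a) ->
  convolution f h g = f a * h (gmul (ginv a) g).
Proof.
move=> ag fa; rewrite /convolution.
rewrite -(@fsbig_widen _ _ _ _ [set (a, gmul (ginv a) g)]) ?fsbig_set1//.
  move=> _ -> /=; split; last by rewrite gmulKV.
  by rewrite /composable /= rng_gmul ?src_ginv// rng_ginv.
move=> [b d] [[]]; rewrite /composable /= => bd bdg /= nba.
have [->|fb] := eqVneq (f b) 0; first by rewrite mul0r.
case: nba; rewrite -bdg.
have ba : b = a by apply: fa => //; rewrite -bdg rng_gmul.
by rewrite -ba gmulVK.
Qed.

Lemma convolution_at0 f h g : (forall b, rng b = rng g -> f b = 0) ->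
  convolution f h g = 0.
Proof.
move=> f0; rewrite /convolution; apply: fsbig1 => -[b d] [].
by rewrite /composable /= => bd bdg; rewrite f0 ?mul0r// -bdg rng_gmul.
Qed.

Lemma closed_equalizer (T T' : topologicalType) (u v : T -> T') :
  hausdorff_space T' -> continuous u -> continuous v ->
  closed [set t | u t = v t].
Proof.
move=> hT cu cv p clp; apply: hT => A B uA vB.
have uA' : nbhs p (u @^-1` A) by exact: cu.
have vB' : nbhs p (v @^-1` B) by exact: cv.
have [q [/= uvq [Aq Bq]]] := clp _ (filterI uA' vB').
by exists (u q); split => //; rewrite uvq.
Qed.

Lemma composable_closed : closed (@composable G).
Proof.
apply: closed_equalizer => // p.
  by apply: continuous_comp; [exact: cvg_fst|exact: src_continuous].
by apply: continuous_comp; [exact: cvg_snd|exact: rng_continuous].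
Qed.

Lemma near_eq_continuous (T : topologicalType) (u v : T -> R[i]) (x : T) :
  (\forall y \near x, u y = v y) -> {for x, continuous (v : T -> R[i]^o)} ->
  {for x, continuous (u : T -> R[i]^o)}.
Proof.
move=> uv /cvg_cabsP cv; apply/cvg_cabsP => e /cv.
by have uvx := nbhs_singleton uv; apply: filterS2 uv => y ->; rewrite uvx.
Qed.

Lemma Cc0 : Cc (@units G) (fun=> 0 : R[i]).
Proof.
by apply/CcP; split; [move=> x; exact: cvg_cst|exists set0 => //; exact: compact0].
Qed.

Lemma CcD f h : Cc (@units G) f -> Cc (@units G) h ->
  Cc (@units G) (fun g => f g + h g).
Proof.
move=> /CcP[cf [K cK Kf]] /CcP[ch [L cL Lh]]; apply/CcP; split.
  by move=> x; exact: (cvgD (cf x) (ch x)).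
exists (K `|` L); first exact: compactU.
by move=> g KLg; rewrite Kf ?Lh ?addr0// => ?; apply: KLg; [right|left].
Qed.

Lemma CcM f h : Cc (@units G) f -> continuous (h : G -> R[i]^o) ->
  Cc (@units G) (fun g => h g * f g).
Proof.
move=> /CcP[cf [K cK Kf]] ch; apply/CcP; split.
  by move=> x; exact: (cvgM (ch x) (cf x)).
by exists K => // g /Kf ->; rewrite mulr0.
Qed.

Lemma CcZ (s : R[i]) f : Cc (@units G) f -> Cc (@units G) (fun g => s * f g).
Proof. by move=> /CcM; apply => x; exact: cvg_cst. Qed.

Lemma involution_Cc f : Cc (@units G) f -> Cc (@units G) (involution f).
Proof.
move=> /CcP[cf [K cK Kf]]; apply/CcP; split.
  move=> x; apply: (@cvg_conjc _ _ _ _ (f \o ginv)).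
  by apply: continuous_comp; [exact: ginv_continuous|exact: cf].
exists (ginv @` K).
  apply: continuous_compact => //; apply: continuous_subspaceT.
  exact: ginv_continuous.
move=> g Kg; rewrite /involution Kf ?rmorph0// => Kg'; apply: Kg.
by exists (ginv g) => //; rewrite ginvK.
Qed.

(** If [rng g0] lies off the closed set of ranges of [K], the convolution vanishes near [g0].
    Otherwise, near [g0], it equals [f (al g) * h (al g^-1 g)] with [al] the section [sigma] after
    [rng]. *)
Lemma convolution_bisection_continuous f h : bisection_supported f ->
  continuous (f : G -> R[i]^o) -> continuous (h : G -> R[i]^o) ->
  continuous (convolution f h : G -> R[i]^o).
Proof.
move=> [K [cK [U [sigma [[oU KU] [W oW rU] csigma sigmaK _]]] Kf]] cf ch g0.
have cKr : closed (rng @` K).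
  apply: compact_closed => //; apply: continuous_compact => //.
  by apply: continuous_subspaceT; exact: rng_continuous.
have [[a0 Ka0 a0g]|nK] := pselect ((rng @` K) (rng g0)); last first.
  apply: (@near_eq_continuous _ _ (fun=> 0)); last exact: cvg_cst.
  have : nbhs g0 (rng @^-1` (~` (rng @` K))).
    by apply: rng_continuous; apply: open_nbhs_nbhs; split => //; exact: closed_openC.
  apply: filterS => g nKg; apply: convolution_at0 => b bg.
  by apply: Kf => Kb; apply: nKg; exists b.
have rUg : \forall g \near g0, (rng @` U) (rng g).
  have : nbhs g0 (rng @^-1` W).
    apply: rng_continuous; apply: open_nbhs_nbhs; split => //.
    by have : (rng @` U) (rng g0); [exists a0 => //; exact: KU|rewrite rU => -[]].
  by apply: filterS => g Wg; rewrite rU; split => //; exact: units_rng.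
have rUg0 := nbhs_singleton rUg.
pose al g := sigma (rng g).
have cal : {for g0, continuous al}.
  move=> N /= sN; have /subspace_continuousP/(_ _ rUg0 _ sN) := csigma.
  by move/rng_continuous; apply: filterS2 rUg => g Ug; apply.
have ral g : (rng @` U) (rng g) -> rng (al g) = rng g.
  by move=> [u Uu ug]; rewrite /al -ug sigmaK.
have cmu : {for g0, continuous (fun g => gmul (ginv (al g)) g)}.
  move=> N /= sN.
  have comp0 : composable (ginv (al g0), g0) by apply: composable_ginv; exact: ral.
  have /subspace_continuousP/(_ _ comp0 _ sN) := @gmul_continuous G.
  have cpair : (fun g => (ginv (al g), g)) @ g0 --> (ginv (al g0), g0).
    apply: cvg_pair; last exact: cvg_id.
    apply: (continuous_comp (f := al)); first exact: cal.
    exact: ginv_continuous.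
  move/cpair; apply: filterS2 rUg => g /ral ag; apply.
  exact: composable_ginv.
apply: (@near_eq_continuous _ _ (fun g => f (al g) * h (gmul (ginv (al g)) g))).
  apply: filterS rUg => g [u Uu ug].
  have -> : al g = u by rewrite /al -ug sigmaK.
  apply: convolution_at => // b bg fb.
  have Kb : K b by apply: contrapT => /Kf fb0; rewrite fb0 eqxx in fb.
  by rewrite -(sigmaK _ (KU _ Kb)) bg -ug sigmaK.
apply: cvgM; first by apply: (continuous_comp (f := al)) => //; exact: cf.
by apply: (continuous_comp (f := fun g => gmul (ginv (al g)) g)) => //; exact: ch.
Qed.

Lemma convolution_Cc f h : Cc (@units G) f -> Cc (@units G) h ->
  Cc (@units G) (convolution f h).
Proof.
move=> Cf Ch; move: f Cf; apply: Cc_ind => [|f1 f2 C1 C2 h1 h2|f Cf bf].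
- have -> : convolution (fun=> 0) h = fun=> 0 :> R[i].
    by apply/funext => g; exact: convolution_at0.
  exact: Cc0.
- by rewrite convolution_addl//; exact: CcD.
- have /CcP[cf [K cK Kf]] := Cf; have /CcP[ch [L cL Lh]] := Ch.
  apply/CcP; split; first exact: convolution_bisection_continuous.
  (* The set of products of composable pairs from [K] and [L] is compact, composability being a
     closed condition in a Hausdorff groupoid. *)
  exists ((fun p => gmul p.1 p.2) @` ((K `*` L) `&` @composable G)).
    apply: continuous_compact.
      apply: continuous_subspaceW (@gmul_continuous G); exact: subIsetr.
    by apply: compact_closedI; [exact: compact_setX|exact: composable_closed].
  move=> g ng; rewrite /convolution; apply: fsbig1 => -[a b] [ab abg] /=.
  have [Ka|/Kf->] := pselect (K a); last by rewrite mul0r.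
  have [Lb|/Lh->] := pselect (L b); last by rewrite mulr0.
  by case: ng; exists (a, b).
Qed.

Lemma involutionK f : involution (involution f) = f.
Proof. by apply/funext => g; rewrite /involution ginvK conjcK. Qed.

Lemma seminorm_le_star (X : set G) (p : (G -> R[i]) -> R) f :
  is_Cstar_seminorm X p -> Cc X f -> Cc X (involution f) ->
  p f <= p (involution f).
Proof.
move=> hp Cf Cf'; have [f0|f0] := eqVneq (p f) 0; first by rewrite f0 (seminorm_ge0 hp).
have fp : 0 < p f by rewrite lt_def f0 (seminorm_ge0 hp).
by rewrite -(ler_pM2r fp) -expr2 -(seminorm_star hp)// (seminorm_conv hp).
Qed.

Lemma convolution_units f : (forall g, ~ units g -> f g = 0) ->
  convolution (involution f) f = fun g => conjc (f g) * f g.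
Proof.
move=> f0; apply/funext => g; have [ug|nug] := pselect (units g).
  have rg : rng g = g by rewrite -[in LHS]ug rng_src ug.
  rewrite (@convolution_at _ _ g) => // [|b bg].
    by rewrite gmulVg ug /involution ginv_unit.
  rewrite /involution => fb; have ub : units (ginv b).
    by apply: contrapT => /f0 fb0; rewrite fb0 rmorph0 eqxx in fb.
  rewrite -[b]ginvK (ginv_unit ub); move: ub; rewrite /units /= => <-.
  by rewrite src_ginv bg.
rewrite (f0 _ nug) mulr0 /convolution; apply: fsbig1 => -[a b] [ab abg] /=.
have [ub|/f0->] := pselect (units b); last by rewrite mulr0.
have [ua|/f0 fa] := pselect (units (ginv a)); last first.
  by rewrite /involution fa rmorph0 mul0r.
case: nug; rewrite /composable /= in ab abg.
have ra : ginv a = a by rewrite -{2}[a]ginvK (ginv_unit ua).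
have rb : rng b = b by rewrite -[in LHS]ub rng_src ub.
rewrite -abg; have <- : src a = b by rewrite ab rb.
by rewrite gmul_src -ra.
Qed.

(** [s] stands for [i] or [- i], both of which are needed below. *)
Lemma conjcM_real_phase (t u : R) (s : R[i]) : s * conjc s = 1 -> conjc s = - s ->
  conjc (t%:C * (t%:C + s * u%:C)) * (t%:C * (t%:C + s * u%:C)) =
  (t ^+ 2 * (t ^+ 2 + u ^+ 2))%:C.
Proof.
move=> s1 cs.
have -> : conjc (t%:C * (t%:C + s * u%:C)) = t%:C * (t%:C + conjc s * u%:C).
  have cM (y z : R[i]) : conjc (y * z) = conjc y * conjc z by exact: rmorphM.
  have cD (y z : R[i]) : conjc (y + z) = conjc y + conjc z by exact: rmorphD.
  by rewrite cM cD cM !conjc_real.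
rewrite cs in s1 *; rewrite [RHS]rmorphM rmorphD !rmorphXn /=.
have s2 : s ^+ 2 = -1 by apply: oppr_inj; rewrite opprK expr2 -mulrN.
transitivity (t%:C ^+ 2 * (t%:C ^+ 2 - s ^+ 2 * u%:C ^+ 2)); first by ring.
by rewrite s2; ring.
Qed.

(* [a := (t + i s) t] and its conjugate, with [s := sqrt (1 - t ^ 2)], satisfy
   [a^* a = t ^ 2] and add up to [2 t ^ 2]; hence [p (t ^ 2) <= p t]. *)
Lemma seminorm_units_le1 (t : G -> R) (p : (G -> R[i]) -> R) :
  Cc (@units G) (fun g => (t g)%:C) -> (forall g, 0 <= t g <= 1) ->
  (forall g, ~ units g -> t g = 0) ->
  is_Cstar_seminorm (@units G) p -> p (fun g => (t g)%:C) <= 1.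
Proof.
move=> Ct t01 t0 hp; set h := fun g => (t g)%:C.
have /CcP[ch _] := Ct.
have ct : continuous (t : G -> R^o).
  by move=> x; exact: (cvg_Re (ch x)).
pose a (s : R[i]) g := (t g)%:C * ((t g)%:C + s * (Num.sqrt (1 - t g ^+ 2))%:C).
have Ca s : Cc (@units G) (a s).
  have -> : a s = fun g => ((t g)%:C + s * (Num.sqrt (1 - t g ^+ 2))%:C) * (t g)%:C.
    by apply/funext => g; rewrite /a mulrC.
  apply: (CcM (f := h)) => // x; apply: cvgD; first exact: ch.
  apply: (@cvgM R[i] _ _ _ (fun=> s)); first exact: cvg_cst.
  apply: (@cvg_real_complex _ _ _ _ (fun y => Num.sqrt (1 - t y ^+ 2))).
  apply: (continuous_comp (f := fun y => 1 - t y ^+ 2)); last exact: sqrt_continuous.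
  apply: (@cvgB R R^o _ _ _ (fun=> 1)); first exact: cvg_cst.
  by apply: (@cvgM R _ _ _ t t); exact: ct.
have h2E : convolution (involution h) h = fun g => (t g ^+ 2)%:C.
  rewrite convolution_units; last by move=> g /t0 tg; rewrite /h tg.
  by apply/funext => g; rewrite conjc_real -rmorphM expr2.
have aE s : s * conjc s = 1 -> conjc s = - s ->
    convolution (involution (a s)) (a s) = fun g => (t g ^+ 2)%:C.
  move=> s1 cs; rewrite convolution_units; last first.
    by move=> g /t0 tg; rewrite /a tg mul0r.
  apply/funext => g; rewrite /a conjcM_real_phase// sqr_sqrtr.
    by rewrite addrC subrK mulr1.
  by rewrite subr_ge0 expr_le1//; have /andP[] := t01 g.
have pa s : s * conjc s = 1 -> conjc s = - s -> p (a s) = p h.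
  move=> s1 cs; apply/eqP; rewrite -(eqrXn2 (n:=2))// ?(seminorm_ge0 hp)//.
  by rewrite -!(seminorm_star hp)// h2E aE.
have [i [i1 i2]] : exists i : R[i], i * conjc i = 1 /\ conjc i = - i.
  exists 'i%R; have ci : conjc 'i%R = - 'i%R :> R[i] by exact: (@conjCi R[i]).
  by rewrite ci mulrN -expr2 (@sqrCi R[i]) opprK.
have Ch2 : Cc (@units G) (fun g => (t g ^+ 2)%:C).
  rewrite -h2E; apply: convolution_Cc => //; exact: involution_Cc.
have le : p (fun g => (t g ^+ 2)%:C) *+ 2 <= p h *+ 2.
  have -> : p (fun g => (t g ^+ 2)%:C) *+ 2 = p (fun g => 2 * (t g ^+ 2)%:C).
    apply: (@complexI R); rewrite (seminorm_scale hp)// normr_nat.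
    by rewrite rmorphMn /= mulr_natl.
  have -> : (fun g => 2 * (t g ^+ 2)%:C) = fun g => a i g + a (- i) g.
    by apply/funext => g; rewrite /a rmorphXn /=; ring.
  have i3 : - i * conjc (- i) = 1 by rewrite rmorphN mulrNN.
  have i4 : conjc (- i) = - - i by rewrite rmorphN /= i2.
  by rewrite (le_trans (seminorm_add hp (Ca _) (Ca _)))// !pa.
have [h0|h0] := eqVneq (p h) 0; first by rewrite h0.
have hpos : 0 < p h by rewrite lt_def h0 (seminorm_ge0 hp).
rewrite -(ler_pM2r hpos) mul1r -expr2 -(seminorm_star hp)// h2E.
by rewrite -(ler_pMn2r (n := 2)).
Qed.

Lemma Cc_bounded f : Cc (@units G) f -> exists2 M, 0 < M & forall g, cabs (f g) <= M.
Proof.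
move=> /CcP[cf [K cK Kf]].
have cabsf : continuous ((fun g => cabs (f g)) : G -> R^o).
  move=> x; apply: (@cvg_Re _ _ _ _ (fun g => `|f g|)).
  apply: (continuous_comp (f := f : G -> R[i]^o)); first exact: cf.
  exact: norm_continuous.
have : compact ((fun g => cabs (f g)) @` K : set R^o).
  by apply: continuous_compact => //; exact: continuous_subspaceT.
move=> /compact_bounded[M [_ hM]]; exists (`|M| + 1); first by rewrite ltr_wpDl.
move=> g; have [Kg|/Kf->] := pselect (K g); last by rewrite cabs0 addr_ge0.
have M1 : M < `|M| + 1 by rewrite ltr_pwDr ?ler_norm.
by rewrite (le_trans (ler_norm _))//; apply: (hM _ M1); exists g.
Qed.

Lemma bisection_seminorm_bound f : Cc (@units G) f -> bisection_supported f ->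
  exists M, forall p, is_Cstar_seminorm (@units G) p -> p f <= M.
Proof.
move=> Cf [K [cK [U [sigma [[oU KU] _ _ sigmaK sinj]]] Kf]].
have [M M0 fM] := Cc_bounded Cf.
have M20 : 0 < M ^+ 2 by rewrite exprn_gt0.
pose F := involution f; have CF : Cc (@units G) F by exact: involution_Cc.
have kE g : exists t, [/\ convolution f F g = t%:C, 0 <= t <= M ^+ 2 &
    ~ units g -> t = 0].
  have [[a Ka ag]|nK] := pselect (exists2 a, K a & rng a = rng g); last first.
    exists 0; split => //; last by rewrite lexx ltW.
    apply: convolution_at0 => b bg; apply: Kf => Kb; apply: nK; by exists b.
  rewrite (@convolution_at f F a g) => // [|b bg fb]; last first.
    have Kb : K b by apply: contrapT => /Kf fb0; rewrite fb0 eqxx in fb.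
    by rewrite -(sigmaK _ (KU _ Kb)) bg -ag sigmaK//; exact: KU.
  set b := ginv (gmul (ginv a) g); rewrite /F /involution -/b.
  have [Kb|nKb] := pselect (K b); last first.
    by exists 0; rewrite (Kf _ nKb) rmorph0 mulr0 lexx ltW.
  have sb : src b = src a by rewrite /b src_ginv rng_gmul ?rng_ginv// src_ginv.
  (* The arrow [b = g^-1 a] of [K] has the same source as [a], so it equals [a], which forces
     [g = a a^-1] to be a unit. *)
  have ba : b = a by exact: sinj.
  exists (cabs (f a) ^+ 2); split.
  - by rewrite ba -sqr_normc cabsE rmorphXn.
  - by rewrite exprn_ge0 ?cabs_ge0//= lerXn2r// ?nnegrE ?cabs_ge0// ltW.
  - case; rewrite -(gmulKV ag); have -> : gmul (ginv a) g = ginv a.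
      by rewrite -{2}ba /b ginvK.
    by rewrite gmulV; exact: units_rng.
have /choice[t ht] := kE.
have tE : convolution f F = fun g => (t g)%:C by apply/funext => g; have [] := ht g.
exists M => p hp; apply: (le_trans (seminorm_le_star hp Cf CF)).
rewrite -(ler_pXn2r (n := 2))// ?nnegrE ?(seminorm_ge0 hp) ?(ltW M0)//.
rewrite -(seminorm_star hp)// involutionK tE.
have Ct : Cc (@units G) (fun g => (t g)%:C) by rewrite -tE; exact: convolution_Cc.
have sE : (fun g => (M ^- 2 * t g)%:C) = fun g => (M ^- 2)%:C * (t g)%:C.
  by apply/funext => g; rewrite rmorphM.
have := @seminorm_units_le1 (fun g => M ^- 2 * t g) p; rewrite sE => le1.
have -> : p (fun g => (t g)%:C) = M ^+ 2 * p (fun g => (M ^- 2)%:C * (t g)%:C).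
  apply: (@complexI R); rewrite rmorphM /= (seminorm_scale hp)// cabsE cabs_real.
  rewrite -rmorphM -rmorphM /= mulrA ger0_norm; last by rewrite invr_ge0 ltW.
  by rewrite divff ?mul1r// gt_eqF.
rewrite ler_piMr ?(ltW M20)//; apply: le1 => // [|g|g ng].
- exact: CcZ.
- have [_ /andP[t0 tM] _] := ht g; rewrite mulr_ge0 ?invr_ge0 ?(ltW M20)//=.
  by rewrite mulrC ler_pdivrMr// mul1r.
- by have [_ _ ->] := ht g; rewrite ?mulr0.
Qed.

(** This makes the [sup] defining [universal_norm] on [G] a genuine supremum; reductions inherit the
    bound through extension of functions. *)
Lemma seminorm_bound f : Cc (@units G) f ->
  exists M, forall p, is_Cstar_seminorm (@units G) p -> p f <= M.
Proof.
move: f; apply: Cc_ind => [|f h Cf Ch [M hM] [N hN]|].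
- exists 0 => p hp; have := seminorm_scale hp 0 Cc0.
  by rewrite normr0 !mul0r => /(@complexI R) ->.
- exists (M + N) => p hp; rewrite (le_trans (seminorm_add hp Cf Ch))//.
  by rewrite lerD ?hM ?hN.
- exact: bisection_seminorm_bound.
Qed.
End EtaleGroupoid.

(** * Cutoff and Tietze extension on locally compact Hausdorff spaces *)

Section LocallyCompactExtension.
Variables (R : realType) (T : topologicalType).
Hypotheses (T_lc : locally_compact [set: T]) (T_hausdorff : hausdorff_space T).
Local Notation opc := (one_point_compactification T).

Let opc_hausdorff : hausdorff_space opc.
Proof. exact: one_point_compactification_hausdorff. Qed.

Let opc_normal : normal_space opc.
Proof.
by apply: compact_normal => //; exact: one_point_compactification_compact.
Qed.

(** Urysohn in the one-point compactification, which is normal, separating [K] from the point at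
    infinity. The support is compact because its complement is a neighbourhood of that point. *)
Lemma compact_cutoff (K : set T) : compact K ->
  exists (psi : T -> R) (C : set T), [/\ continuous psi, compact C,
    forall t, K t -> psi t = 1 & forall t, ~ C t -> psi t = 0].
Proof.
move=> cK; have cSK : closed (Some @` K : set opc).
  apply: compact_closed => //; apply: continuous_compact => //.
  apply: continuous_subspaceT; exact: one_point_compactification_some_continuous.
have cN : closed [set None : opc].
  have -> : [set None : opc] = ~` (Some @` [set: T]).
    apply/seteqP; split => [_ -> [t _]//|[t|//]] nt.
    by case: nt; exists t.
  by apply: open_closedC; apply: one_point_compactification_open_some; exact: openT.
have /(_ (Some @` K) [set None] cSK cN) sep := (@normal_separatorP R opc).1 opc_normal.
have [|psi [W [C [cpsi _ [_ KO] [cC CN] [psi1 psi0]]]]] :=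
  @urysohn_cutoff R _ _ _ (sep _).
  by apply/seteqP; split => // -[t|] [] //= [s _].
exists (psi \o Some), (Some @^-1` C); split.
- move=> t; apply: continuous_comp; last exact: cpsi.
  exact: one_point_compactification_some_continuous.
- have : nbhs (None : opc) (~` C).
    by apply: open_nbhs_nbhs; split; [exact: closed_openC|exact: CN].
  move=> [K' [cK' clK'] K'C].
  apply: (subclosed_compact _ cK') => [|t Ct].
    apply: (@closed_comp _ _ (Some : T -> opc) C) => // s _.
    exact: one_point_compactification_some_continuous.
  by apply: contrapT => nK't; apply: (K'C (Some t)) => //; left; exists t.
- by move=> t Kt; apply: psi1; apply: KO; exists t.
- by move=> t Ct; exact: psi0.
Qed.

(** Tietze in the one-point compactification, for the closed set [C] with infinity added and [u]
    extended by 0 there; continuity at infinity holds because [u] vanishes off the compact set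
    [K]. *)
Lemma tietze_extension (C K : set T) (u : T -> R) : closed C -> compact K ->
  K `<=` C -> {within C, continuous (u : T -> R^o)} ->
  (forall t, ~ K t -> u t = 0) ->
  exists2 v : T -> R^o, continuous v & forall t, C t -> v t = u t.
Proof.
move=> cC cK KC cu Ku; pose C' : set opc := Some @` C `|` [set None].
pose u' (o : opc) : R^o := if o is Some t then u t else 0.
have clC' : closed C'.
  have -> : C' = ~` (Some @` (~` C)).
    apply/seteqP; split=> [y|[t|] h].
    - by move=> [[t Ct <-]|->] [s Cs] // [st]; apply: Cs; rewrite st.
    - by left; exists t => //; apply: contrapT => nC; apply: h; exists t.
    - by right.
  apply: open_closedC; apply: one_point_compactification_open_some.
  exact: closed_openC.
have cu' : {within C', continuous u'}.
  apply/subspace_continuousP => -[t [[s Cs [<-]]|//]|_] N /= uN.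
    have h1 : nbhs s [set r | C r -> N (u r)].
      by have /subspace_continuousP/(_ _ Cs _ uN) := cu.
    suff : nbhs s [set r | C' (Some r) -> N (u r)] by [].
    by apply: filterS h1 => r h [[q Cq [qr]]|//]; apply: h; rewrite -qr.
  exists K; first by split => //; exact: compact_closed.
  move=> o h; have o0 : u' o = 0 by case: h => [[t Kt <-]|->] //=; exact: Ku.
  move=> _; suff : N (u' o) by [].
  by rewrite o0; exact: nbhs_singleton uN.
have [M [_ hM]] : bounded_set (u @` K : set R^o).
  apply: compact_bounded; apply: continuous_compact => //.
  exact: continuous_subspaceW cu.
have M1 : M < `|M| + 1 by rewrite ltr_pwDr ?ler_norm.
have [|y _|v [v1 v2 _]] :=
  @continuous_bounded_extension _ _ opc_normal C' clC' u' (`|M| + 1) _ cu'.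
- by rewrite ltr_wpDl.
- case: y => [t|] /=; last by rewrite normr0 addr_ge0.
  have [Kt|/Ku->] := pselect (K t); last by rewrite normr0 addr_ge0.
  by apply: (hM _ M1); exists t.
exists (v \o Some).
  move=> t; apply: continuous_comp; last exact: v2.
  exact: one_point_compactification_some_continuous.
by move=> t Ct /=; rewrite -v1// inE; left; exists t.
Qed.

End LocallyCompactExtension.

Lemma restriction_in (R : realType) (G : groupoidType) (X : set G)
  (f : G -> R[i]) g : reduction X g -> restriction X f g = f g.
Proof. by move=> Xg; rewrite /restriction patchT// inE. Qed.

Lemma restriction_out (R : realType) (G : groupoidType) (X : set G)
  (f : G -> R[i]) g : ~ reduction X g -> restriction X f g = 0.
Proof. by move=> Xg; rewrite /restriction patchN// inE/=; apply/negP; rewrite inE. Qed.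

(** * Restriction to closed invariant sets of units *)

Section Restriction.
Variables (R : realType) (G : topGroupoidType).
Implicit Types (f h : G -> R[i]) (a b g x : G) (X Y : set G).

Lemma invariant_rng X g : invariant_set X -> X (rng g) -> X (src g).
Proof. by move=> iX; have := iX (ginv g); rewrite src_ginv rng_ginv. Qed.

Lemma restriction_Cc X Y f : Y `<=` X -> closed (reduction Y) -> Cc X f ->
  Cc Y (restriction Y f).
Proof.
move=> YX cY [cf [K [cK KX Kf]]]; split.
  apply/subspace_continuousP => x Yx; rewrite /from_subspace restriction_in//.
  have /subspace_continuousP/(_ _ Yx) :
      {within reduction Y, continuous (f : G -> R[i]^o)}.
    by apply: continuous_subspaceW cf => g; exact: YX.
  apply: cvg_trans; apply: fmap_within_eq => g; rewrite inE => Yg.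
  exact: restriction_in.
exists (K `&` reduction Y); split => [||g KYg].
- exact: compact_closedI.
- exact: subIsetr.
- have [Yg|nYg] := pselect (reduction Y g); last exact: restriction_out.
  by rewrite restriction_in// Kf// => Kg; apply: KYg.
Qed.

Lemma restriction_comp X Y f : Y `<=` X ->
  restriction Y (restriction X f) = restriction Y f.
Proof.
move=> YX; apply/funext => g.
have [Yg|nYg] := pselect (reduction Y g); last by rewrite !restriction_out.
by rewrite !restriction_in//; exact: YX.
Qed.

Lemma restriction_linear X (s : R[i]) f h :
  restriction X (fun g => s * f g + h g) =
  fun g => s * restriction X f g + restriction X h g.
Proof.
apply/funext => g; have [Xg|nXg] := pselect (reduction X g).
  by rewrite !restriction_in.
by rewrite !restriction_out// mulr0 addr0.
Qed.

Lemma restriction_mul X (s : G -> R[i]) f :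
  restriction X (fun g => s g * f g) = fun g => s g * restriction X f g.
Proof.
apply/funext => g; have [Xg|nXg] := pselect (reduction X g).
  by rewrite !restriction_in.
by rewrite !restriction_out// mulr0.
Qed.

Lemma restriction_add X f h :
  restriction X (fun g => f g + h g) =
  fun g => restriction X f g + restriction X h g.
Proof.
apply/funext => g; have [Xg|nXg] := pselect (reduction X g).
  by rewrite !restriction_in.
by rewrite !restriction_out// addr0.
Qed.

Lemma restriction_involution X f : invariant_set X ->
  restriction X (involution f) = involution (restriction X f).
Proof.
move=> iX; apply/funext => g; rewrite /involution.
have [Xg|nXg] := pselect (reduction X g).
  by rewrite !restriction_in// /reduction /= src_ginv; exact: iX.
rewrite !restriction_out ?rmorph0// /reduction /= src_ginv => Xg.
by apply: nXg; exact: invariant_rng.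
Qed.

Lemma restriction_convolution X f h : invariant_set X ->
  restriction X (convolution f h) =
  convolution (restriction X f) (restriction X h).
Proof.
move=> iX; apply/funext => g.
have [Xg|nXg] := pselect (reduction X g).
  rewrite restriction_in//; apply: eq_fsbigr => -[a b].
  rewrite inE /composable /= => -[ab abg].
  have Xb : reduction X b by rewrite /reduction /= -(src_gmul _ _ ab) abg.
  by rewrite !restriction_in// /reduction /= ab; exact: iX.
rewrite restriction_out//; apply/esym; apply: fsbig1 => -[a b].
rewrite /composable /= => -[ab abg]; rewrite (@restriction_out _ _ _ h) ?mulr0//.
by rewrite /reduction /= -(src_gmul _ _ ab) abg.
Qed.

Lemma closed_reduction_setC (U : set G) : lch_etale G ->
  relatively_open (@units G) U -> closed (reduction (@units G `\` U)).
Proof.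
move=> hG [W oW ->]; have -> : reduction (@units G `\` (@units G `&` W)) =
    src @^-1` (~` W).
  apply/seteqP; split => g /=; rewrite /reduction /=.
    by move=> [_ h] Wg; apply: h; split => //; exact: units_src.
  by move=> h; split; [exact: units_src|case].
apply: (@closed_comp _ _ (src : G -> G)); first by move=> x _; exact: src_continuous.
exact: open_closedC.
Qed.

Lemma invariant_setC (U : set G) : invariant_set U ->
  invariant_set (@units G `\` U).
Proof.
move=> iU g [_ nU]; split; first exact: units_rng.
by move=> Ug; apply: nU; exact: invariant_rng.
Qed.

Hypothesis hG : lch_etale G.

(** Tietze extension of real and imaginary part loses compact support; the factor [psi] restores it
    without changing the values on [reduction X], as it is 1 on [K] and [f] vanishes elsewhere. *)
Lemma Cc_extension X f : closed (reduction X) -> Cc X f ->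
  exists2 F, Cc (@units G) F & restriction X F = f.
Proof.
move=> cX [cf [K [cK KX Kf]]]; have [G_lc G_hausdorff _] := hG.
have [psi [C [cpsi cC psi1 psi0]]] := @compact_cutoff R _ G_lc G_hausdorff _ cK.
have fE g : f g = (complex.Re (f g))%:C + 'i%R * (complex.Im (f g))%:C.
  exact: complexE.
have cf' x : reduction X x ->
    (f : G -> R[i]^o) @ within (reduction X) (nbhs x) --> (f x : R[i]^o).
  by move=> Xx; have /subspace_continuousP/(_ _ Xx) := cf.
have [||vr cvr vrE] := @tietze_extension R _ G_lc G_hausdorff _ _
    (fun g => complex.Re (f g)) cX cK KX.
- by apply/subspace_continuousP => x /cf' h; exact: cvg_Re h.
- by move=> g /Kf ->.
have [||vi cvi viE] := @tietze_extension R _ G_lc G_hausdorff _ _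
    (fun g => complex.Im (f g)) cX cK KX.
- by apply/subspace_continuousP => x /cf' h; exact: cvg_Im h.
- by move=> g /Kf ->.
exists (fun g => (psi g)%:C * ((vr g)%:C + 'i%R * (vi g)%:C)).
  apply/CcP; split; last by exists C => // g /psi0 ->; rewrite mul0r.
  move=> x; apply: cvgM; first by apply: cvg_real_complex; exact: cpsi.
  apply: cvgD; first by apply: cvg_real_complex; exact: cvr.
  apply: (@cvgM R[i] _ _ _ (fun=> 'i%R)); first exact: cvg_cst.
  by apply: cvg_real_complex; exact: cvi.
apply/funext => g; have [Xg|nXg] := pselect (reduction X g); last first.
  by rewrite restriction_out// Kf// => /KX.
rewrite restriction_in// vrE// viE// -fE.
have [Kg|/Kf->] := pselect (K g); last by rewrite mulr0.
by rewrite psi1// mul1r.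
Qed.

Lemma seminorm_restriction X (p : (G -> R[i]) -> R) : closed (reduction X) ->
  invariant_set X -> X `<=` @units G -> is_Cstar_seminorm X p ->
  is_Cstar_seminorm (@units G) (p \o restriction X).
Proof.
move=> cX iX Xu hp.
have rC f : Cc (@units G) f -> Cc X (restriction X f) by exact: restriction_Cc.
split => [f Cf|f1 f2 C1 C2|s f Cf|f1 f2 C1 C2|f Cf] /=.
- by apply: (seminorm_ge0 hp); exact: rC.
- by rewrite restriction_add; apply: (seminorm_add hp); exact: rC.
- by rewrite restriction_mul (seminorm_scale hp)//; exact: rC.
- by rewrite restriction_convolution//; apply: (seminorm_conv hp); exact: rC.
- rewrite restriction_convolution// restriction_involution//.
  by apply: (seminorm_star hp); exact: rC.
Qed.

(** The seminorms on [Cc X] are bounded at [f] because, composed with restriction, they become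
    seminorms on [G], bounded at an extension [F] of [f]. *)
Lemma seminorm_le_universal X (p : (G -> R[i]) -> R) f : closed (reduction X) ->
  invariant_set X -> X `<=` @units G -> is_Cstar_seminorm X p -> Cc X f ->
  p f <= universal_norm X f.
Proof.
move=> cX iX Xu hp Cf; apply: ub_le_sup; last by exists p.
have [F CF FE] := Cc_extension cX Cf.
have [M hM] := seminorm_bound hG CF; exists M => _ [q hq <-].
by rewrite -FE; exact: (hM _ (seminorm_restriction cX iX Xu hq)).
Qed.

(** The two closed reductions cover [G], and [f] is continuous on each of them, being zero on the
    second. *)
Lemma Cc_paste X Y f : closed (reduction X) -> closed (reduction Y) ->
  X `|` Y = @units G -> Cc X f -> (forall g, reduction Y g -> f g = 0) ->
  Cc (@units G) f.
Proof.
move=> cX cY XY [cf [K [cK KX Kf]]] fY; apply/CcP; split; last by exists K.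
have -> : continuous (f : G -> R[i]^o) =
    {within reduction X `|` reduction Y, continuous (f : G -> R[i]^o)}.
  have -> : reduction X `|` reduction Y = setT.
    apply/seteqP; split => // g _; rewrite /reduction /setU /=.
    by have := units_src g; rewrite -XY.
  by apply/propext; exact: continuous_subspace_setT.
apply: withinU_continuous => //; apply/subspace_continuousP => x Yx.
apply/cvg_cabsP => e e0; apply: (@filterS _ _ _ (reduction Y)).
  by move=> g Yg; rewrite /from_subspace !fY// subrr cabs0.
exact: withinT.
Qed.

End Restriction.

(** * Groupoid C*-algebras, gauge actions and restrictions *)

Section FullAlgebra.
Variables (R : realType) (G : topGroupoidType) (X : set G).
Variables (A : cstarAlgType R) (iota : (G -> R[i]) -> A).
Hypothesis hA : is_full_Cstar_algebra X iota.
Implicit Types (f h : G -> R[i]) (a : A).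

Lemma iota0 : Cc X (fun=> 0 : R[i]) -> iota (fun=> 0) = 0.
Proof.
move=> C0; apply: (@addrI _ (iota (fun=> 0))); rewrite addr0.
rewrite -{1}[iota _]scale1r -(iota_linear hA)//.
by congr (iota _); apply/funext => g; rewrite mulr0 addr0.
Qed.

Lemma iotaD f h : Cc X f -> Cc X h ->
  iota (fun g => f g + h g) = iota f + iota h.
Proof.
move=> Cf Ch; rewrite -[iota f]scale1r -(iota_linear hA)//.
by congr (iota _); apply/funext => g; rewrite mul1r.
Qed.

Lemma iotaZ (s : R[i]) f : Cc X (fun=> 0 : R[i]) -> Cc X f ->
  iota (fun g => s * f g) = s *: iota f.
Proof.
move=> C0 Cf; rewrite -[RHS]addr0 -(iota0 C0) -(iota_linear hA)//.
by congr (iota _); apply/funext => g; rewrite addr0.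
Qed.

Lemma iota_approx a (e : R) : 0 < e -> exists2 f, Cc X f & rnorm (iota f - a) < e.
Proof.
move=> e0; have : closure [set iota f | f in @Cc R G X] a by rewrite (iota_dense hA).
have : nbhs a (ball a e%:C) by apply: nbhsx_ballx; rewrite ltcR.
move=> nb /(_ _ nb)[_ [[f Cf <-]]]; rewrite -ball_normE /= rnormE ltcR => fa.
by exists f => //; rewrite rnorm_distC.
Qed.

(** Both maps are contractive, so their difference is bounded and has closed kernel. *)
Lemma star_hom_dense_eq (B : cstarAlgType R) (phi psi : A -> B) :
  is_star_hom phi -> is_star_hom psi ->
  (forall f, Cc X f -> phi (iota f) = psi (iota f)) -> forall a, phi a = psi a.
Proof.
move=> hphi hpsi h a; apply/eqP; rewrite -subr_eq0; apply/eqP.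
apply: (@approx_closed_ker _ _ _ (fun y => phi y - psi y) 2) => [x y|x|e e0].
- rewrite (star_homB hphi) (star_homB hpsi) !opprD !opprK.
  by rewrite [LHS]addrACA.
- rewrite (le_trans (rnormB _ _))// mulr_natl mulr2n.
  by rewrite lerD ?star_hom_le.
- have [f Cf fa] := iota_approx a e0; exists (iota f) => //=.
  by rewrite h// subrr.
Qed.

End FullAlgebra.

Lemma cvg_exprz (K : numFieldType) (T : Type) (F : set_system T) {FF : Filter F}
    (f : T -> K) (l : K) (n : int) :
  l != 0 -> f @ F --> l -> (fun t => f t ^ n) @ F --> l ^ n.
Proof.
move=> l0 fl; have cX m : (fun t => f t ^+ m) @ F --> l ^+ m.
  elim: m => [|m IH]; first exact: cvg_cst.
  rewrite exprS (_ : (fun t => _) = f \* (fun t => f t ^+ m)); last first.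
    by apply/funext => t; rewrite exprS.
  exact: cvgM.
case: n => n; first exact: cX.
by rewrite NegzE -exprnN; apply: cvgV; [rewrite expf_neq0|exact: cX].
Qed.

(** * Gauge actions *)

Section Gauge.
Variables (R : realType) (G : topGroupoidType) (X : set G) (c : G -> int).
Hypothesis c_continuous : continuous (c : G -> discrete_topology int).
Variables (A : cstarAlgType R) (iota : (G -> R[i]) -> A).
Hypothesis hA : is_full_Cstar_algebra X iota.
Variable alpha : R[i] -> A -> A.
Hypothesis halpha : is_gauge_action X c iota alpha.
Implicit Types (f h : G -> R[i]).

Lemma cocycle_level_open x : nbhs x [set g | c g = c x].
Proof.
have : nbhs (c x : discrete_topology int) [set c x].
  by apply: open_nbhs_nbhs; split => //; exact: discrete_open.
by move/c_continuous.
Qed.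

(** [c] is locally constant, so [u] can be arbitrary; powers of [z] and indicators of a single level
    both occur. *)
Lemma Cc_cocycle_mul (u : int -> R[i]) f : Cc X f ->
  Cc X (fun g => u (c g) * f g).
Proof.
move=> [cf [K [cK KX Kf]]]; split; last first.
  by exists K; split => // g /Kf ->; rewrite mulr0.
apply/subspace_continuousP => x Xx; apply: cvgM.
  apply/cvg_cabsP => e e0.
  have : within (reduction X) (nbhs x) [set g | c g = c x].
    rewrite /within /=; apply: filterS (cocycle_level_open x) => g gx _.
    exact: gx.
  apply: filterS => g /= ->.
  by rewrite subrr cabs0.
by have /subspace_continuousP/(_ _ Xx) := cf.
Qed.

Lemma Cc_finite_levels f : Cc X f ->
  exists s : seq int, forall g, f g != 0 -> c g \in s.
Proof.
move=> [_ [K [cK _ Kf]]].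
have [x|s hs] := @compact_finite_cover G K (fun x => [set g | c g = c x]) cK.
  split => //; rewrite openE => g /= gx; rewrite /interior -gx.
  exact: cocycle_level_open.
exists [seq c i | i <- s] => g fg.
have Kg : K g by apply: contrapT => /Kf fg0; rewrite fg0 eqxx in fg.
by have [i si /= ->] := hs _ Kg; exact: map_f.
Qed.

Lemma circle_neq0 (z : R[i]) : circle z -> z != 0.
Proof. by move=> z1; rewrite -normr_eq0 z1 oner_neq0. Qed.

Let C0 : Cc X (fun=> 0 : R[i]).
Proof.
split; first by apply/subspace_continuousP => x _; exact: cvg_cst.
by exists set0; split => //; exact: compact0.
Qed.

(** On the part of [f] where [c = n], multiplication by [z ^ c g] is the scalar [z ^ n], which is
    continuous at [z0 != 0]. The induction splits off the finitely many levels one by one. *)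
Lemma iota_cocycle_cvg (T : Type) (F : set_system T) {FF : Filter F}
    (u : T -> R[i]) (z0 : R[i]) (s : seq int) f : Cc X f ->
  (forall g, f g != 0 -> c g \in s) -> z0 != 0 ->
  (u : T -> R[i]^o) @ F --> (z0 : R[i]^o) ->
  (fun t => iota (fun g => u t ^ c g * f g)) @ F --> iota (fun g => z0 ^ c g * f g).
Proof.
move=> + + z00 uz0; elim: s f => [|n s IH] f Cf fs.
  have f0 z : (fun g => z ^ c g * f g) = fun=> 0.
    apply/funext => g; have [->|/fs//] := eqVneq (f g) 0; exact: mulr0.
  have -> : (fun t => iota (fun g => u t ^ c g * f g)) = fun=> iota (fun=> 0).
    by apply/funext => t; rewrite f0.
  by rewrite f0; exact: cvg_cst.
pose f1 g : R[i] := (c g == n)%:R * f g; pose f2 g : R[i] := (c g != n)%:R * f g.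
have Cf1 : Cc X f1 by exact: (Cc_cocycle_mul (fun m => (m == n)%:R)).
have Cf2 : Cc X f2 by exact: (Cc_cocycle_mul (fun m => (m != n)%:R)).
have iE z : iota (fun g => z ^ c g * f g) =
    z ^ n *: iota f1 + iota (fun g => z ^ c g * f2 g).
  have Czf2 := Cc_cocycle_mul (fun m => z ^ m) Cf2.
  rewrite -(iota_linear hA _ Cf1 Czf2).
  congr (iota _); apply/funext => g; rewrite /f1 /f2.
  by have [->|cn] := eqVneq (c g) n; rewrite !(mul0r, mul1r, mulr0, addr0, add0r).
have -> : (fun t => iota (fun g => u t ^ c g * f g)) =
    fun t => u t ^ n *: iota f1 + iota (fun g => u t ^ c g * f2 g).
  by apply/funext => t; exact: iE.
rewrite iE; apply: cvgD.
  by apply: cvgZr_tmp; apply: (@cvg_exprz R[i]).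
apply: (IH f2) => // g; rewrite /f2; have [->|cn] := eqVneq (c g) n.
  by rewrite mul0r eqxx.
by rewrite mul1r => /fs; rewrite inE (negPf cn).
Qed.

Lemma gauge_circle_action : is_circle_action alpha.
Proof.
have c1 : circle (1 : R[i]) by rewrite /circle /= normr1.
split => [z z1|a|z w z1 w1 a|a].
- by have [] := halpha z1.
- have [h1 h2] := halpha c1.
  apply: (star_hom_dense_eq hA h1 (star_hom_id A)) => f Cf.
  by rewrite h2//; congr (iota _); apply/funext => g; rewrite exp1rz mul1r.
- have zw1 : circle (z * w) by rewrite /circle /= normrM z1 w1 mulr1.
  have [h1 h2] := halpha zw1; have [h3 h4] := halpha z1; have [h5 h6] := halpha w1.
  apply: (star_hom_dense_eq hA h1 (star_hom_comp h5 h3)) => f Cf /=.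
  rewrite h2// h6// h4//; last exact: Cc_cocycle_mul.
  by congr (iota _); apply/funext => g; rewrite expfzMl mulrA.
(* An argument with three thirds of [e]: [a] is replaced by a nearby [iota f], at equal cost for
   [alpha z] and [alpha z0], as both are contractive. *)
- apply/subspace_continuousP => z0 z01; apply/cvg_rnormP => e e0.
  have e3 : 0 < e / 3 by rewrite divr_gt0.
  have [f Cf fa] := iota_approx hA a e3.
  have [s fs] := Cc_finite_levels Cf.
  have fz0 := nbhs_filter (z0 : R[i]^o).
  have /cvg_rnormP/(_ _ e3) := @iota_cocycle_cvg _ (nbhs (z0 : R[i]^o)) fz0 id _ _ _
    Cf fs (circle_neq0 z01) (@cvg_id _ _).
  move=> near0; rewrite /within /=; apply: (@filterS _ _ fz0) near0 => z hz z1.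
  have [h1 h2] := halpha z1; have [h3 h4] := halpha z01.
  rewrite (le_lt_trans (rnorm_dist_triangle (alpha z (iota f)) _ _))//.
  have -> : e = e / 3 + (e / 3 + e / 3) by field.
  rewrite ltrD//.
    by rewrite -(star_homB h1) (le_lt_trans (star_hom_le h1 _))// rnorm_distC.
  rewrite (le_lt_trans (rnorm_dist_triangle (alpha z0 (iota f)) _ _))// ltrD//.
    by rewrite h2// h4.
  by rewrite -(star_homB h3) (le_lt_trans (star_hom_le h3 _)).
Qed.

End Gauge.

(** * Kernel and image of a restriction *)

Section RestrictionKernel.
Variables (R : realType) (G : topGroupoidType) (X : set G).
Hypotheses (hG : lch_etale G) (Xu : X `<=` @units G).
Hypotheses (cX : closed (reduction X)) (iX : invariant_set X).
Variables (A B : cstarAlgType R) (iota : (G -> R[i]) -> A).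
Variables (iotaB : (G -> R[i]) -> B) (rho : A -> B).
Hypotheses (hA : is_full_Cstar_algebra (@units G) iota).
Hypotheses (hB : is_full_Cstar_algebra X iotaB).
Hypothesis hrho : is_canonical_restriction (@units G) X iota iotaB rho.
Implicit Types (f h F : G -> R[i]) (a b : A).

Definition vanishing_Cc f := Cc (@units G) f /\ restriction X f = fun=> 0.

Definition vanishing_ideal : set A :=
  [set a | forall e : R, 0 < e -> exists2 f, vanishing_Cc f & rnorm (iota f - a) < e].

Local Notation J := vanishing_ideal.

Let rC f : Cc (@units G) f -> Cc X (restriction X f).
Proof. exact: restriction_Cc. Qed.

Let CcX0 : Cc X (fun=> 0 : R[i]).
Proof.
have := rC (Cc0 R G); congr (Cc X _); apply/funext => g.
have [Xg|nXg] := pselect (reduction X g); last exact: restriction_out.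
exact: restriction_in.
Qed.

Let iotaZu (s : R[i]) f : Cc (@units G) f -> iota (fun g => s * f g) = s *: iota f.
Proof. by apply: iotaZ => //; exact: Cc0. Qed.

Let iotaBu f h : Cc (@units G) f -> Cc (@units G) h ->
  iota (fun g => f g - h g) = iota f - iota h.
Proof.
move=> Cf Ch; have := iotaD hA Cf (CcZ (-1) Ch); rewrite iotaZu// scaleN1r => <-.
by congr (iota _); apply/funext => g; rewrite mulN1r.
Qed.

Lemma vanishing_ideal_iota f : vanishing_Cc f -> J (iota f).
Proof. by move=> Jf e e0; exists f => //; rewrite subrr rnorm0. Qed.

Lemma vanishing_convolution h f : Cc (@units G) h -> vanishing_Cc f ->
  vanishing_Cc (convolution h f).
Proof.
move=> Ch [Cf f0]; split; first exact: convolution_Cc.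
rewrite restriction_convolution// f0; apply/funext => g.
by apply: fsbig1 => -[a b] _; rewrite mulr0.
Qed.

Lemma vanishing_ideal_closed_ideal : is_closed_ideal J.
Proof.
split.
- rewrite -(iota0 hA (Cc0 R G)); apply: vanishing_ideal_iota.
  split; first exact: Cc0.
  by apply/funext => g; rewrite /restriction /patch; case: ifP.
- move=> a b Ia Ib e e0; have e2 : 0 < e / 2 by rewrite divr_gt0.
  have [f [Cf f0] fa] := Ia _ e2; have [h [Ch h0] hb] := Ib _ e2.
  exists (fun g => f g + h g).
    split; first exact: CcD.
    by rewrite restriction_add f0 h0; apply/funext => g; rewrite addr0.
  rewrite (iotaD hA)// opprD addrACA (splitr e).
  by rewrite (le_lt_trans (rnormD _ _))// ltrD.
- move=> s a Ia e e0; have s1 : 0 < cabs s + 1 by rewrite ltr_wpDl ?cabs_ge0.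
  have [f [Cf f0] fa] := Ia _ (divr_gt0 e0 s1).
  exists (fun g => s * f g).
    split; first exact: CcZ.
    by rewrite (restriction_mul X (fun=> s)) f0; apply/funext => g; rewrite mulr0.
  rewrite iotaZu// -scalerBr rnormZ.
  rewrite (@le_lt_trans _ _ ((cabs s + 1) * rnorm (iota f - a)))//.
    by rewrite ler_wpM2r ?rnorm_ge0// lerDl.
  by rewrite mulrC -ltr_pdivlMr.
- move=> a x Ix e e0; have e2 : 0 < e / 2 by rewrite divr_gt0.
  have a1 : 0 < rnorm a + 1 by rewrite ltr_wpDl ?rnorm_ge0.
  have [f Jf fx] := Ix _ (divr_gt0 e2 a1); have [Cf f0] := Jf.
  have f1 : 0 < rnorm (iota f) + 1 by rewrite ltr_wpDl ?rnorm_ge0.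
  have [h Ch ha] := iota_approx hA a (divr_gt0 e2 f1).
  exists (convolution h f); first exact: vanishing_convolution.
  rewrite (iota_conv hA)//.
  have -> : cmul (iota h) (iota f) - cmul a x =
      cmul (iota h - a) (iota f) + cmul a (iota f - x).
    by rewrite cmulBl cmulBr addrA subrK.
  rewrite (splitr e) (le_lt_trans (rnormD _ _))// ltrD//.
    rewrite (le_lt_trans (rnormM _ _))//.
    rewrite (@le_lt_trans _ _ (rnorm (iota h - a) * (rnorm (iota f) + 1)))//.
      by rewrite ler_wpM2l ?rnorm_ge0// lerDl.
    by rewrite -ltr_pdivlMr.
  rewrite (le_lt_trans (rnormM _ _))//.
  rewrite (@le_lt_trans _ _ ((rnorm a + 1) * rnorm (iota f - x)))//.
    by rewrite ler_wpM2r ?rnorm_ge0// lerDl.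
  by rewrite mulrC -ltr_pdivlMr.
- move=> x Ix e /Ix[f [Cf f0] fx]; exists (involution f).
    split; first exact: involution_Cc.
    rewrite restriction_involution// f0; apply/funext => g.
    by rewrite /involution rmorph0.
  by rewrite (iota_involution hA)// -cstarB rnorm_star.
- move=> x Icl e e0; have e2 : 0 < e / 2 by rewrite divr_gt0.
  have [y Iy yx] := Icl _ e2; have [f Jf fy] := Iy _ e2.
  exists f => //; rewrite (le_lt_trans (rnorm_dist_triangle y _ _))// (splitr e).
  by rewrite ltrD.
Qed.

Let hI := vanishing_ideal_closed_ideal.

Lemma quotient_norm_restriction_eq f h : Cc (@units G) f -> Cc (@units G) h ->
  restriction X f = restriction X h ->
  quotient_norm J (iota f) = quotient_norm J (iota h).
Proof.
move=> Cf Ch fh; apply: (quotient_norm_eq hI).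
rewrite -iotaBu//; apply: vanishing_ideal_iota; split.
  have -> : (fun g => f g - h g) = fun g => f g + (-1) * h g.
    by apply/funext => g; rewrite mulN1r.
  by apply: CcD => //; exact: CcZ.
have -> : (fun g => f g - h g) = fun g => (-1) * h g + f g.
  by apply/funext => g; rewrite mulN1r addrC.
by rewrite restriction_linear fh; apply/funext => g; rewrite mulN1r addNr.
Qed.

(* The quotient norm of [A / J], transported to [Cc X], is a C*-seminorm, hence
   dominated by the universal one. *)
Lemma quotient_norm_iota_le f : Cc (@units G) f ->
  quotient_norm J (iota f) <= rnorm (rho (iota f)).
Proof.
move=> Cf; have [_ rhoE] := hrho.
(* [E] picks an extension to [G] of each function on the reduction. By [qE'] any other extension
   gives the same value, so [q] can be computed on sums and products of chosen extensions. *)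
have /choice[E hE] h : exists F, Cc X h -> Cc (@units G) F /\ restriction X F = h.
  have [/(Cc_extension hG cX)[F CF FE]|nC] := pselect (Cc X h); first by exists F.
  by exists h.
pose q h := quotient_norm J (iota (E h)).
have qE F : Cc (@units G) F -> q (restriction X F) = quotient_norm J (iota F).
  by move=> CF; have [CE EE] := hE _ (rC CF); exact: quotient_norm_restriction_eq.
have qE' h F : Cc (@units G) F -> restriction X F = h -> q h = quotient_norm J (iota F).
  by move=> CF <-; exact: qE.
have hq : is_Cstar_seminorm X q.
  split => [h Ch|h1 h2 C1 C2|s h Ch|h1 h2 C1 C2|h Ch].
  - exact: (quotient_norm_ge0 hI).
  - have [CE1 EE1] := hE _ C1; have [CE2 EE2] := hE _ C2.
    rewrite (qE' _ (fun g => E h1 g + E h2 g)).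
    + by rewrite (iotaD hA)//; exact: (quotient_normD hI).
    + exact: CcD.
    + by rewrite restriction_add EE1 EE2.
  - have [CE EE] := hE _ Ch; rewrite (qE' _ (fun g => s * E h g)).
    + by rewrite iotaZu// (quotient_normZ hI) rmorphM /= -cabsE.
    + exact: CcZ.
    + by rewrite (restriction_mul X (fun=> s)) EE.
  - have [CE1 EE1] := hE _ C1; have [CE2 EE2] := hE _ C2.
    rewrite (qE' _ (convolution (E h1) (E h2))).
    + by rewrite (iota_conv hA)//; exact: (quotient_normM hI).
    + exact: convolution_Cc.
    + by rewrite restriction_convolution// EE1 EE2.
  - have [CE EE] := hE _ Ch.
    rewrite (qE' _ (convolution (involution (E h)) (E h))).
    + rewrite (iota_conv hA)//; last exact: involution_Cc.
      by rewrite (iota_involution hA)// (quotient_norm_starM hI).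
    + by apply: convolution_Cc => //; exact: involution_Cc.
    + by rewrite restriction_convolution// restriction_involution// EE.
rewrite rhoE// -qE//.
have := seminorm_le_universal hG cX iX Xu hq (rC Cf).
by rewrite /rnorm (iota_norm hB)//; exact: rC.
Qed.

(** Passage from [iota f] to all of [A] by density: both sides change by at most the distance of the
    arguments. *)
Lemma quotient_norm_le_restriction a : quotient_norm J a <= rnorm (rho a).
Proof.
have [hr _] := hrho; apply/ler_addgt0Pr => e e0.
have e2 : 0 < e / 2 by rewrite divr_gt0.
have [f Cf fa] := iota_approx hA a e2.
have -> : a = (a - iota f) + iota f by rewrite subrK.
rewrite (le_trans (quotient_normD hI _ _))//.
rewrite (le_trans (lerD (quotient_norm_le_norm hI _) (quotient_norm_iota_le Cf)))//.
rewrite subrK -[rho (iota f)](subrK (rho a)) (splitr e) -(star_homB hr).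
rewrite rnorm_distC.
have := rnormD (rho (iota f - a)) (rho a); have := star_hom_le hr (iota f - a).
by lra.
Qed.

Lemma restriction_kernel a : rho a = 0 <-> J a.
Proof.
have [hr rhoE] := hrho; split => [ra|Ia].
  apply: (quotient_norm_eq0 hI).
  by rewrite (le_trans (quotient_norm_le_restriction a))// ra rnorm0.
apply: rnorm_small0 => e /Ia[f [Cf f0] fa].
have -> : rho a = rho (a - iota f).
  by rewrite (star_homB hr) rhoE// f0 (iota0 hB CcX0) subr0.
by rewrite (le_lt_trans (star_hom_le hr _))// rnorm_distC.
Qed.

(** An approximant of [d] in [Cc X] is extended to [G]; the quotient norm then allows a correction
    in the kernel that brings the norm of the preimage below [2 |d|]. *)
Lemma restriction_onto (b : B) : exists a, rho a = b.
Proof.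
have [hr rhoE] := hrho.
suff h (d : B) : setT d -> exists a, [/\ [set: A] a, rnorm a <= 2 * rnorm d,
    rnorm (d - rho a) <= rnorm d / 2 & [set: B] (d - rho a)].
  have [//|a _ <-] := onto_of_approx (star_homD hr) (star_hom_le hr)
    (I : [set: A] 0) (fun _ _ _ _ => I) (fun _ _ => I) h (b := b).
  by exists a.
move=> _; have [d0|d0] := eqVneq (rnorm d) 0.
  exists 0; rewrite (star_hom0 hr) subr0 rnorm0 d0 mulr0 mul0r; split => //.
have dp : 0 < rnorm d by rewrite lt_def d0 rnorm_ge0.
(* With error [|d| / 4] the approximant has norm at most [5/4 |d|], strictly below the required
   [2 |d|]. *)
have d4 : 0 < rnorm d / 4 by rewrite divr_gt0.
have [h Ch hd] := iota_approx hB d d4.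
have [F CF FE] := Cc_extension hG cX Ch.
have rF : rho (iota F) = iotaB h by rewrite rhoE// FE.
have rh : rnorm (iotaB h) <= rnorm d + rnorm d / 4.
    have := rnormD (iotaB h - d) d; rewrite subrK; lra.
have [k Ik kF] : exists2 k, J k & rnorm (iota F + k) < 2 * rnorm d.
  apply: (quotient_norm_lt hI); apply: le_lt_trans (quotient_norm_iota_le CF) _.
  by rewrite rF; lra.
exists (iota F + k); rewrite (star_homD hr) rF (restriction_kernel k).2// addr0.
split => //; first exact: ltW.
by rewrite rnorm_distC; lra.
Qed.

End RestrictionKernel.

Section Equivariance.
Variables (R : realType) (G : topGroupoidType) (c : G -> int) (X Y : set G).
Hypothesis c_continuous : continuous (c : G -> discrete_topology int).
Hypotheses (YX : Y `<=` X) (cY : closed (reduction Y)).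
Variables (A B : cstarAlgType R) (iotaA : (G -> R[i]) -> A).
Variables (iotaB : (G -> R[i]) -> B) (rho : A -> B).
Variables (alpha : R[i] -> A -> A) (beta : R[i] -> B -> B).

Lemma restriction_equivariant : is_full_Cstar_algebra X iotaA ->
  is_canonical_restriction X Y iotaA iotaB rho ->
  is_gauge_action X c iotaA alpha -> is_gauge_action Y c iotaB beta ->
  is_equivariant_star_hom alpha beta rho.
Proof.
move=> hA [hr rhoE] ha hb; split => // z z1.
have [h1 h2] := ha z z1; have [h3 h4] := hb z z1.
apply: (star_hom_dense_eq hA (star_hom_comp h1 hr) (star_hom_comp hr h3)) => f Cf /=.
have Czf := Cc_cocycle_mul c_continuous (fun n => z ^ n) Cf.
rewrite h2// (rhoE _ Czf) (restriction_mul Y (fun g => z ^ c g)) rhoE//.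
by rewrite h4//; exact: (restriction_Cc YX).
Qed.

End Equivariance.

(** * The square of restrictions *)

Section Square.
Variables (R : realType) (G : topGroupoidType) (X1 X2 : set G).
Hypotheses (hG : lch_etale G) (X12 : X1 `|` X2 = @units G).
Hypotheses (cX1 : closed (reduction X1)) (iX1 : invariant_set X1).
Hypotheses (cX2 : closed (reduction X2)) (iX2 : invariant_set X2).
Variables (A A1 A2 A12 : cstarAlgType R) (iota : (G -> R[i]) -> A).
Variables (iota1 : (G -> R[i]) -> A1) (iota2 : (G -> R[i]) -> A2).
Variables (iota12 : (G -> R[i]) -> A12).
Variables (rho1 : A -> A1) (rho2 : A -> A2) (chi1 : A1 -> A12) (chi2 : A2 -> A12).
Hypothesis hA : is_full_Cstar_algebra (@units G) iota.
Hypothesis hA1 : is_full_Cstar_algebra X1 iota1.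
Hypothesis hA2 : is_full_Cstar_algebra X2 iota2.
Hypothesis hA12 : is_full_Cstar_algebra (X1 `&` X2) iota12.
Hypothesis hrho1 : is_canonical_restriction (@units G) X1 iota iota1 rho1.
Hypothesis hrho2 : is_canonical_restriction (@units G) X2 iota iota2 rho2.
Hypothesis hchi1 : is_canonical_restriction X1 (X1 `&` X2) iota1 iota12 chi1.
Hypothesis hchi2 : is_canonical_restriction X2 (X1 `&` X2) iota2 iota12 chi2.
Implicit Types (f h : G -> R[i]) (a b : A).

Local Notation J1 := (vanishing_ideal X1 iota).
Local Notation J2 := (vanishing_ideal X2 iota).

Let X1u : X1 `<=` @units G. Proof. by rewrite -X12; exact: subsetUl. Qed.
Let X2u : X2 `<=` @units G. Proof. by rewrite -X12; exact: subsetUr. Qed.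

Let cX12 : closed (reduction (X1 `&` X2)). Proof. exact: closedI. Qed.

Let iX12 : invariant_set (X1 `&` X2).
Proof. by move=> g [X1g X2g]; split; [exact: iX1|exact: iX2]. Qed.

Let ideal1 : is_closed_ideal J1. Proof. exact: vanishing_ideal_closed_ideal. Qed.
Let ideal2 : is_closed_ideal J2. Proof. exact: vanishing_ideal_closed_ideal. Qed.

(** For composable [a] and [b], the middle unit [src a = rng b] lies in [X1], and then [f a = 0], or
    in [X2], and then [h b = 0] by invariance. *)
Lemma vanishing_convolution0 f h : vanishing_Cc X1 f -> vanishing_Cc X2 h ->
  convolution f h = fun=> 0.
Proof.
move=> [_ f0] [_ h0]; apply/funext => g; apply: fsbig1 => -[a b] [].
rewrite /composable /= => ab _.
have : (X1 `|` X2) (src a) by rewrite X12; exact: units_src.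
case=> [X1a|X2a].
  have -> : f a = restriction X1 f a by rewrite restriction_in.
  by rewrite f0 mul0r.
have -> : h b = restriction X2 h b.
  by rewrite restriction_in//; apply: invariant_rng => //; rewrite -ab.
by rewrite h0 mulr0.
Qed.

Lemma vanishing_ideal_mul0 a b : J1 a -> J2 b -> cmul a b = 0.
Proof.
move=> J1a J2b; apply: rnorm_small0 => e e0.
have e2 : 0 < e / 2 by rewrite divr_gt0.
have b1 : 0 < rnorm b + 1 by rewrite ltr_wpDl ?rnorm_ge0.
have [f Jf fa] := J1a _ (divr_gt0 e2 b1); have [Cf _] := Jf.
have f1 : 0 < rnorm (iota f) + 1 by rewrite ltr_wpDl ?rnorm_ge0.
have [h Jh hb] := J2b _ (divr_gt0 e2 f1); have [Ch _] := Jh.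
have fh : cmul (iota f) (iota h) = 0.
  by rewrite -(iota_conv hA)// vanishing_convolution0// (iota0 hA (Cc0 R G)).
have -> : cmul a b = cmul (a - iota f) b + cmul (iota f) (b - iota h).
  by rewrite cmulBl cmulBr fh subr0 subrK.
rewrite (splitr e) (le_lt_trans (rnormD _ _))// ltrD//.
  rewrite (le_lt_trans (rnormM _ _))// rnorm_distC.
  rewrite (@le_lt_trans _ _ (rnorm (iota f - a) * (rnorm b + 1)))//.
    by rewrite ler_wpM2l ?rnorm_ge0// lerDl.
  by rewrite -ltr_pdivlMr.
rewrite (le_lt_trans (rnormM _ _))// rnorm_distC.
rewrite (@le_lt_trans _ _ ((rnorm (iota f) + 1) * rnorm (iota h - b)))//.
  by rewrite ler_wpM2r ?rnorm_ge0// lerDl.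
by rewrite mulrC -ltr_pdivlMr.
Qed.

Lemma restrictions_injective a b : rho1 a = rho1 b -> rho2 a = rho2 b -> a = b.
Proof.
have [[h1 _] [h2 _]] := (hrho1, hrho2).
move=> e1 e2; apply/eqP; rewrite -subr_eq0; apply/eqP; apply: rnorm_eq0.
have J1ab : J1 (a - b).
  apply/(restriction_kernel hG X1u cX1 iX1 hA hA1 hrho1).
  by rewrite (star_homB h1) e1 subrr.
have J2ab : J2 (a - b).
  apply/(restriction_kernel hG X2u cX2 iX2 hA hA2 hrho2).
  by rewrite (star_homB h2) e2 subrr.
have : rnorm (a - b) ^+ 2 = 0.
  by rewrite -rnorm_starM vanishing_ideal_mul0 ?rnorm0//; exact: (ideal_star ideal1).
by move/eqP; rewrite expf_eq0 => /andP[_ /eqP].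
Qed.

Lemma restriction_square f : Cc (@units G) f ->
  chi1 (rho1 (iota f)) = iota12 (restriction (X1 `&` X2) f) /\
  chi2 (rho2 (iota f)) = iota12 (restriction (X1 `&` X2) f).
Proof.
have [[_ r1] [_ r2]] := (hrho1, hrho2); have [[_ s1] [_ s2]] := (hchi1, hchi2).
move=> Cf; rewrite r1// r2// s1 ?s2 ?restriction_comp//;
  exact: (@restriction_Cc _ _ (@units G)).
Qed.

Lemma restriction_square_commutes a : chi1 (rho1 a) = chi2 (rho2 a).
Proof.
have [[r1 _] [r2 _]] := (hrho1, hrho2); have [[s1 _] [s2 _]] := (hchi1, hchi2).
apply: (star_hom_dense_eq hA (star_hom_comp r1 s1) (star_hom_comp r2 s2)).
by move=> f Cf /=; have [-> ->] := restriction_square Cf.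
Qed.

(* For [j] in [J1] and [i] in [J2], [j^* i = 0], whence
   [|j|^2 = |j^* (j + i)|]. *)
Lemma vanishing_ideal_isometric a : J1 a -> rnorm a <= rnorm (rho2 a).
Proof.
move=> J1a; apply: le_trans
  (quotient_norm_le_restriction hG X2u cX2 iX2 hA hA2 hrho2 a).
apply: (quotient_norm_lb ideal2) => i J2i.
have [->|a0] := eqVneq (rnorm a) 0; first exact: rnorm_ge0.
have ap : 0 < rnorm a by rewrite lt_def a0 rnorm_ge0.
rewrite -(ler_pM2l ap) -expr2 -rnorm_starM -(rnorm_star a).
have <- : cmul (cstar a) (a + i) = cmul (cstar a) a.
  by rewrite cmulDr (vanishing_ideal_mul0 (ideal_star ideal1 J1a) J2i) addr0.
exact: rnormM.
Qed.

(* A function on [reduction X2] that vanishes on [reduction (X1 `&` X2)] is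
   already continuous on the whole groupoid, being zero on [reduction X1]. *)
Lemma vanishing_restriction f : vanishing_Cc (X1 `&` X2) f ->
  vanishing_Cc X1 (restriction X2 f).
Proof.
move=> [Cf f0]; have f10 g : reduction X1 g -> restriction X2 f g = 0.
  move=> X1g; have [X2g|nX2g] := pselect (reduction X2 g); last exact: restriction_out.
  have -> : restriction X2 f g = restriction (X1 `&` X2) f g.
    by rewrite !restriction_in.
  by rewrite f0.
split.
  apply: (Cc_paste cX2 cX1) => //; first by rewrite setUC.
  exact: (@restriction_Cc _ _ (@units G)).
apply/funext => g; have [X1g|nX1g] := pselect (reduction X1 g).
  by rewrite restriction_in// f10.
exact: restriction_out.
Qed.

(** A lift [a] of [d] under [rho2] is approximated by some [f] vanishing over both sets of units.
    Cutting [f] down to [reduction X2] leaves its image under [rho2] unchanged and moves it into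
    [J1]. *)
Lemma kernel_onto (b : A2) : chi2 b = 0 -> exists2 j, J1 j & rho2 j = b.
Proof.
have [[r1 _] [r2 r2E]] := (hrho1, hrho2); have [[s1 _] [s2 _]] := (hchi1, hchi2).
(* As a canonical restriction itself, the composite has a known kernel, to which the lift of [d]
   belongs. *)
have hrho12 :
    is_canonical_restriction (@units G) (X1 `&` X2) iota iota12 (chi2 \o rho2).
  split; first exact: star_hom_comp.
  by move=> f Cf /=; have [_ ->] := restriction_square Cf.
have X12u : X1 `&` X2 `<=` @units G by move=> x [/X1u].
suff h (d : A2) : [set d | chi2 d = 0] d -> exists a, [/\ J1 a,
    rnorm a <= 2 * rnorm d, rnorm (d - rho2 a) <= rnorm d / 2 &
    [set d | chi2 d = 0] (d - rho2 a)].
  by apply: (onto_of_approx (star_homD r2) (star_hom_le r2) (ideal0 ideal1)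
    (idealD ideal1) (ideal_closed ideal1) h).
move=> /= d0; have [nd|nd] := eqVneq (rnorm d) 0.
  exists 0; rewrite (star_hom0 r2) subr0 rnorm0 nd mulr0 mul0r; split => //.
  exact: ideal0 ideal1.
have dp : 0 < rnorm d by rewrite lt_def nd rnorm_ge0.
have d2 : 0 < rnorm d / 2 by rewrite divr_gt0.
have [a ad] := restriction_onto hG X2u cX2 iX2 hA hA2 hrho2 d.
have /(_ _ d2)[f Jf fa] : vanishing_ideal (X1 `&` X2) iota a.
  apply/(restriction_kernel hG X12u cX12 iX12 hA hA12 hrho12).
  by rewrite /= ad.
have [Cf _] := Jf; have J1f := vanishing_restriction Jf; have [Cf1 _] := J1f.
have J1j : J1 (iota (restriction X2 f)) by exact: vanishing_ideal_iota.
have rj : rho2 (iota (restriction X2 f)) = rho2 (iota f).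
  by rewrite !r2E// restriction_comp.
have le : rnorm (d - rho2 (iota f)) < rnorm d / 2.
  by rewrite -ad -(star_homB r2) (le_lt_trans (star_hom_le r2 _))// ad rnorm_distC.
exists (iota (restriction X2 f)); split => //.
(* The isometry bounds the norm by [|rho2 (iota f)| <= |d| + |d| / 2]. *)
- rewrite (le_trans (vanishing_ideal_isometric J1j))// rj.
  have := rnorm_dist_triangle d (rho2 (iota f)) 0; rewrite !subr0 rnorm_distC.
  lra.
- by rewrite rj ltW.
(* The residual stays in the kernel of [chi2], since on [J1] the composite [chi2 rho2 = chi1 rho1]
   vanishes. *)
- rewrite /= (star_homB s2) d0 -restriction_square_commutes.
  rewrite (restriction_kernel hG X1u cX1 iX1 hA hA1 hrho1 _).2//.
  by rewrite (star_hom0 s1) subr0.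
Qed.

(** Any lift [a1] of [b1] misses [b2] by an element of the kernel of [chi2]; a correction in [J1]
    repairs this and is invisible to [rho1]. *)
Lemma restrictions_onto_pullback (b1 : A1) (b2 : A2) : chi1 b1 = chi2 b2 ->
  exists a, rho1 a = b1 /\ rho2 a = b2.
Proof.
have [[r1 _] [r2 _]] := (hrho1, hrho2); have [_ [s2 _]] := (hchi1, hchi2).
have [a1 <-] := restriction_onto hG X1u cX1 iX1 hA hA1 hrho1 b1.
rewrite restriction_square_commutes => /eqP; rewrite eq_sym -subr_eq0.
rewrite -(star_homB s2) => /eqP/kernel_onto[k J1k kb]; exists (a1 + k).
rewrite (star_homD r1) (star_homD r2) kb.
rewrite (restriction_kernel hG X1u cX1 iX1 hA hA1 hrho1 k).2// addr0.
by rewrite addrC subrK.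
Qed.

End Square.

(** [phi d] is the only point over the pair [phi1 d], [phi2 d]. Joint injectivity of [rho1] and
    [rho2] transfers linearity, multiplicativity, compatibility with the star and equivariance to
    [phi]. *)
Lemma pullback_square_of_bijective (R : realType) (A B1 B2 C : cstarAlgType R)
    (alpha : R[i] -> A -> A) (beta1 : R[i] -> B1 -> B1)
    (beta2 : R[i] -> B2 -> B2) (kappa : R[i] -> C -> C)
    (rho1 : A -> B1) (rho2 : A -> B2) (chi1 : B1 -> C) (chi2 : B2 -> C) :
  [/\ is_circle_action alpha, is_circle_action beta1,
    is_circle_action beta2 & is_circle_action kappa] ->
  [/\ is_equivariant_star_hom alpha beta1 rho1,
    is_equivariant_star_hom alpha beta2 rho2,
    is_equivariant_star_hom beta1 kappa chi1 &
    is_equivariant_star_hom beta2 kappa chi2] ->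
  (forall a, chi1 (rho1 a) = chi2 (rho2 a)) ->
  (forall a b, rho1 a = rho1 b -> rho2 a = rho2 b -> a = b) ->
  (forall b1 b2, chi1 b1 = chi2 b2 -> exists a, rho1 a = b1 /\ rho2 a = b2) ->
  is_pullback_square alpha beta1 beta2 kappa rho1 rho2 chi1 chi2.
Proof.
move=> hact hhom comm inj onto; split => //; first exact/funext.
move=> D delta phi1 phi2 hd [h1 e1] [h2 e2] comp.
have [[r1 er1] [r2 er2] _ _] := hhom.
have /choice[phi hphi] d : exists a, rho1 a = phi1 d /\ rho2 a = phi2 d.
  exact/onto/(congr1 (fun u => u d) comp).
have phi1E d : rho1 (phi d) = phi1 d by have [] := hphi d.
have phi2E d : rho2 (phi d) = phi2 d by have [] := hphi d.
exists phi; split; last first.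
  move=> psi [_ p1 p2]; apply/funext => d; apply: inj.
    by rewrite phi1E -p1.
  by rewrite phi2E -p2.
split; [|exact/funext|exact/funext].
split; first split => [s x y|x y|x].
- apply: inj; rewrite ?(star_hom_linear r1) ?(star_hom_linear r2).
    by rewrite !phi1E (star_hom_linear h1).
  by rewrite !phi2E (star_hom_linear h2).
- apply: inj; rewrite ?(star_hom_mul r1) ?(star_hom_mul r2).
    by rewrite !phi1E (star_hom_mul h1).
  by rewrite !phi2E (star_hom_mul h2).
- apply: inj; rewrite ?(star_hom_star r1) ?(star_hom_star r2).
    by rewrite !phi1E (star_hom_star h1).
  by rewrite !phi2E (star_hom_star h2).
- move=> z z1 d; apply: inj; first by rewrite er1// !phi1E e1.
  by rewrite er2// !phi2E e2.
Qed.

Unset Implicit Arguments.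

Theorem theorem3p1 (R : realType) (G : topGroupoidType) (c : G -> int)
  (U1 U2 : set G) (X1 := @units G `\` U1) (X2 := @units G `\` U2)
  (A A1 A2 A12 : cstarAlgType R)
  (iota : (G -> R[i]) -> A) (iota1 : (G -> R[i]) -> A1)
  (iota2 : (G -> R[i]) -> A2) (iota12 : (G -> R[i]) -> A12)
  (rho1 : A -> A1) (rho2 : A -> A2) (chi1 : A1 -> A12) (chi2 : A2 -> A12)
  (gamma : R[i] -> A -> A) (gamma1 : R[i] -> A1 -> A1)
  (gamma2 : R[i] -> A2 -> A2) (gamma12 : R[i] -> A12 -> A12) :
  lch_etale G ->
  is_cocycle c -> continuous (c : G -> discrete_topology int) ->
  U1 `<=` @units G -> relatively_open (@units G) U1 -> invariant_set U1 ->
  U2 `<=` @units G -> relatively_open (@units G) U2 -> invariant_set U2 ->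
  U1 `&` U2 = set0 ->
  is_full_Cstar_algebra (@units G) iota ->
  is_full_Cstar_algebra X1 iota1 ->
  is_full_Cstar_algebra X2 iota2 ->
  is_full_Cstar_algebra (X1 `&` X2) iota12 ->
  is_canonical_restriction (@units G) X1 iota iota1 rho1 ->
  is_canonical_restriction (@units G) X2 iota iota2 rho2 ->
  is_canonical_restriction X1 (X1 `&` X2) iota1 iota12 chi1 ->
  is_canonical_restriction X2 (X1 `&` X2) iota2 iota12 chi2 ->
  is_gauge_action (@units G) c iota gamma ->
  is_gauge_action X1 c iota1 gamma1 ->
  is_gauge_action X2 c iota2 gamma2 ->
  is_gauge_action (X1 `&` X2) c iota12 gamma12 ->
  is_pullback_square gamma gamma1 gamma2 gamma12 rho1 rho2 chi1 chi2 /\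
  [/\ is_equivariant_star_hom gamma (prod_action gamma1 gamma2)
        (fun a : A => (rho1 a, rho2 a)) &
      set_bij [set: A] (pullback chi1 chi2) (fun a : A => (rho1 a, rho2 a))].
Proof.
move=> hG _ cc U1u oU1 iU1 U2u oU2 iU2 U12 hA hA1 hA2 hA12 hr1 hr2 hs1 hs2.
move=> hg hg1 hg2 hg12.
have cX1 : closed (reduction X1) by exact: closed_reduction_setC.
have cX2 : closed (reduction X2) by exact: closed_reduction_setC.
have iX1 : invariant_set X1 by exact: invariant_setC.
have iX2 : invariant_set X2 by exact: invariant_setC.
have cX12 : closed (reduction (X1 `&` X2)) by exact: closedI.
have X12 : X1 `|` X2 = @units G.
  by rewrite /X1 /X2 -setDIr U12 setD0.
have X1u : X1 `<=` @units G by move=> x [].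
have X2u : X2 `<=` @units G by move=> x [].
have er1 : is_equivariant_star_hom gamma gamma1 rho1.
  exact: (restriction_equivariant cc X1u cX1 hA hr1).
have er2 : is_equivariant_star_hom gamma gamma2 rho2.
  exact: (restriction_equivariant cc X2u cX2 hA hr2).
have es1 : is_equivariant_star_hom gamma1 gamma12 chi1.
  exact: (restriction_equivariant cc (@subIsetl _ _ _) cX12 hA1 hs1).
have es2 : is_equivariant_star_hom gamma2 gamma12 chi2.
  exact: (restriction_equivariant cc (@subIsetr _ _ _) cX12 hA2 hs2).
have comm := restriction_square_commutes X12 cX1 cX2 hA hr1 hr2 hs1 hs2.
have inj := restrictions_injective hG X12 cX1 iX1 cX2 iX2 hA hA1 hA2 hr1 hr2.
have onto := restrictions_onto_pullback hG X12 cX1 iX1 cX2 iX2 hA hA1 hA2 hA12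
  hr1 hr2 hs1 hs2.
split.
  apply: pullback_square_of_bijective => //; split.
  - exact: (gauge_circle_action cc hA hg).
  - exact: (gauge_circle_action cc hA1 hg1).
  - exact: (gauge_circle_action cc hA2 hg2).
  - exact: (gauge_circle_action cc hA12 hg12).
have [[h1 e1] [h2 e2]] := (er1, er2).
split.
  split; first split => [s x y|x y|x].
  - by rewrite (star_hom_linear h1) (star_hom_linear h2).
  - by rewrite (star_hom_mul h1) (star_hom_mul h2).
  - by rewrite (star_hom_star h1) (star_hom_star h2).
  - by move=> z z1 a; rewrite e1// e2.
split => [a _|a b _ _ [] ea eb|[b1 b2] /onto[a [/= <- <-]]].
- exact: comm.
- exact: inj.
- by exists a.
Qed.
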